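(* Let $1<p<\infty$. There exists a constant $C_p$ such that for every $\lambda>0$ and every $f\in H^p(\mathbb{T})$ with $\|f\|_p=1$ there exist $f_0\in H^1(\mathbb{T})$ and $f_1\in H^\infty(\mathbb{T})$ such that $$f=f_0+f_1,\qquad \|f_1\|_\infty\le\lambda,\qquad \|f_0\|_1\le C_p\,\lambda^{1-p}.$$
   Context: $\mathbb{T}$ is the unit circle with normalized Lebesgue measure $m$, and $\mathbb{D}$ is the open unit disk. $H^p(\mathbb{T})$ is the classical Hardy space: the subspace of those $f\in L^p(\mathbb{T})$ whose harmonic (Poisson) extension to $\mathbb{D}$ is analytic in $\mathbb{D}$; it carries the norm $\|\cdot\|_p$ of $L^p(\mathbb{T})$. *)

(* Defs.v *)
From HB Require Import structures.
From mathcomp Require Import all_boot all_order all_algebra.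
From mathcomp Require Import complex.
From mathcomp Require Import all_classical all_reals all_analysis.
Set Implicit Arguments.
Unset Strict Implicit.
Unset Printing Implicit Defensive.
Import Order.TTheory GRing.Theory Num.Theory.
Import numFieldNormedType.Exports.
Local Open Scope classical_set_scope.
Local Open Scope complex_scope.
Local Open Scope ring_scope.

(* The norm of the numDomainType R[i] takes its values in R[i]; the R-valued
   modulus is [Normc.normc]. *)
Notation modulus := Normc.normc.

Record circle (R : realType) : Type :=
  Circle { circle_val :> R[i] ; _ : modulus circle_val == 1 }.

HB.instance Definition _ (R : realType) := [isSub for @circle_val R].
HB.instance Definition _ (R : realType) := [Choice of circle R by <:].

Lemma modulus_cis (R : realType) (t : R) : modulus (cos t +i* sin t) == 1.
Proof. by rewrite /= cos2Dsin2 sqrtr1. Qed.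

Definition cis (R : realType) (t : R) : circle R :=
  Circle (modulus_cis t).

HB.instance Definition _ (R : realType) := isPointed.Build (circle R) (cis 0).

(* A subset of the circle is measurable when the set of angles t with e^(it)
   in it is Borel. As t |-> e^(it) is a local homeomorphism onto the circle,
   this is the Borel sigma-algebra of the circle. *)
Definition circle_measurable (R : realType) : set (set (circle R)) :=
  image_set_system setT (@cis R) measurable.

Section circle_measurable.
Variable R : realType.

Let sigma_circle : sigma_algebra setT (@circle_measurable R).
Proof. by apply: sigma_algebra_image; exact: sigma_algebra_measurable. Qed.

Let circle_measurable0 : @circle_measurable R set0.
Proof. by case: sigma_circle. Qed.

Let circle_measurableC (A : set (circle R)) :
  circle_measurable A -> circle_measurable (~` A).
Proof. by case: sigma_circle => _ + _ mA => /(_ _ mA); rewrite setTD. Qed.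

Let circle_measurable_bigcup (F : (set (circle R))^nat) :
  (forall i, circle_measurable (F i)) -> circle_measurable (\bigcup_i F i).
Proof. by case: sigma_circle => _ _; exact. Qed.

HB.instance Definition _ := @isMeasurable.Build (sigma_display (@circle_measurable R))
  (circle R) (@circle_measurable R)
  circle_measurable0 circle_measurableC circle_measurable_bigcup.

End circle_measurable.

Lemma measurable_cis (R : realType) : measurable_fun setT (@cis R).
Proof. by move=> _ A. Qed.

Lemma pi2_gt0 (R : realType) : 0 < 2 * pi :> R.
Proof. by rewrite mulr_gt0 ?pi_gt0. Qed.

(* dt / (2 pi) on [0, 2 pi], carried to the circle by t |-> e^(it). *)
Definition circle_measure (R : realType) : set (circle R) -> \bar R :=
  pushforward (uniform_prob (pi2_gt0 R)) (@cis R).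

HB.instance Definition _ (R : realType) :=
  Measure.copy (@circle_measure R)
    (measure_function_pushforward__canonical__measure_function_Measure
       (uniform_prob (pi2_gt0 R)) (@measurable_cis R)).

Section Hardy.
Variable R : realType.
Implicit Types (p : \bar R) (f : circle R -> R[i]) (z : R[i]).

Definition circle_norm p f : \bar R :=
  'N[@circle_measure R]_p[(fun w => (modulus (f w))%:E)].

(* Functions, not classes modulo almost everywhere equality. *)
Definition circle_Lp p : set (circle R -> R[i]) :=
  [set f | [/\ measurable_fun setT (fun w => complex.Re (f w)),
               measurable_fun setT (fun w => complex.Im (f w)) &
               (circle_norm p f < +oo)%E]].

Definition circle_integral f : R[i] :=
  Rintegral (@circle_measure R) setT (fun w => complex.Re (f w)) +i*
  Rintegral (@circle_measure R) setT (fun w => complex.Im (f w)).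

Definition poisson_kernel z (w : circle R) : R :=
  (1 - modulus z ^+ 2) / modulus (val w - z) ^+ 2.

(* Only meaningful for z in the open unit disk. *)
Definition poisson_extension f z : R[i] :=
  circle_integral (fun w => (poisson_kernel z w)%:C * f w).

(* Differentiability of F : R[i] -> R[i] as a map of the normed R[i]-module
   R[i]^o, i.e. in the complex sense. *)
Definition analytic_on_disk (F : R[i] -> R[i]) : Prop :=
  forall z, modulus z < 1 -> derivable (F : R[i]^o -> R[i]^o) z 1.

Definition Hardy p : set (circle R -> R[i]) :=
  [set f | circle_Lp p f /\ analytic_on_disk (poisson_extension f)].

End Hardy.

(* Main.v *)
From HB Require Import structures.
Require Import Defs.
From mathcomp Require Import all_boot all_order all_algebra.
From mathcomp Require Import complex.
From mathcomp Require Import ring lra.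
From mathcomp Require Import all_classical all_reals all_analysis.
From mathcomp Require Import measurable_realfun ess_sup_inf.
Import Order.TTheory GRing.Theory Num.Theory.
Import numFieldNormedType.Exports.
Local Open Scope classical_set_scope.
Local Open Scope ring_scope.

(* Let l = lambda / 3. We construct phi in H^oo with |phi| <= 1, with
   |f| |phi|^2 <= l almost everywhere and with int |1 - phi|^2 <= C l^(-p). Then
   f1 = f phi^2 (2 - phi^2) is bounded by 3 l, and f0 = f (1 - phi^2)^2 satisfies
   |f0| <= 4 l |1 - phi|^2 where |f| <= l and |f0| <= 4 |f| <= 4 l^(1 - p) |f|^p
   elsewhere, so that its integral is O(l^(1 - p)).
   The function phi is 1 / (1 + G) where Re G >= 0 is at least (|f| / l)^(1/2) on
   {|f| > l}. In place of the conjugate function we use a series G of polynomials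
   2^(j + 2) Q_j, with Re Q_j a trigonometric polynomial between 0 and 1 close to
   the indicator of {|f| > 4^j l}; by Chebyshev's inequality these sets have
   measure at most (2^(-j) l^(-1/2))^(2 p), so that the series converges in L^2
   for p > 1. The only estimate on Q_j is int |Q_j|^2 <= 2 int (Re Q_j)^2, valid
   because int Q_j^2 = Q_j(0)^2 >= 0 when Im Q_j(0) = 0. *)

(** * Complex-valued functions on the circle *)

(** The factor [phi^2 (2 - phi^2)] is chosen because its complement [(1 - phi^2)^2] vanishes to
    second order at [phi = 1]. A first-order complement would bring in the integral of [|1 - phi|],
    which an L^2 bound controls only by [l^(-p/2)], the wrong power for large [l]. The square root
    places the height [|f|^(1/2)] in L^(2p), above the exponent 2 at which passing from [Re Q_j] to
    [Q_j] costs only a constant. Approximation by trigonometric polynomials is in the mean, so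
    [Re Q_j] may miss a small part of its level set, where [|phi|] would not be small. Each missed
    part is handed on to the next index, whose weight is larger, and what is missed forever is null.
    Products with [phi] stay in H^1 because [phi] is almost everywhere a bounded limit of inverses
    of polynomials with real part at least 1. This argument runs on vanishing negative Fourier
    coefficients, so analyticity of the Poisson extension is translated into that condition and
    back. *)

Section ModulusTheory.
Set Implicit Arguments.
Unset Strict Implicit.
Context {R : realType}.
Implicit Types (x y z : R[i]) (r : R).

Lemma modulusE z : modulus z = Num.sqrt (complex.Re z ^+ 2 + complex.Im z ^+ 2).
Proof. by case: z. Qed.

Lemma modulus_ge0 z : 0 <= modulus z.
Proof. by rewrite modulusE sqrtr_ge0. Qed.

Lemma sqr_modulus z : modulus z ^+ 2 = complex.Re z ^+ 2 + complex.Im z ^+ 2.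
Proof. by rewrite modulusE sqr_sqrtr// addr_ge0 ?sqr_ge0. Qed.

Lemma modulusD x y : modulus (x + y) <= modulus x + modulus y.
Proof. exact: le_normcD. Qed.

Lemma modulusN x : modulus (- x) = modulus x.
Proof. exact: normcN. Qed.

Lemma modulusB x y : modulus (x - y) <= modulus x + modulus y.
Proof. by rewrite -(modulusN y) modulusD. Qed.

Lemma modulus_distC x y : modulus (x - y) = modulus (y - x).
Proof. by rewrite -modulusN opprB. Qed.

Lemma modulusX x n : modulus (x ^+ n) = modulus x ^+ n.
Proof. by elim: n => [|n IH]; rewrite ?expr0 ?Normc.normc1// !exprS Normc.normcM IH. Qed.

Lemma modulus_eq0 x : (modulus x == 0) = (x == 0).
Proof.
by apply/eqP/eqP => [/Normc.eq0_normc//|->]; rewrite Normc.normc0.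
Qed.

Lemma modulus_gt0 x : (0 < modulus x) = (x != 0).
Proof. by rewrite lt_neqAle modulus_ge0 andbT eq_sym modulus_eq0. Qed.

Lemma modulus_real r : modulus (r%:C)%C = `|r|.
Proof. by rewrite modulusE /= expr0n addr0 sqrtr_sqr. Qed.

Lemma modulus_conj z : modulus (z^*)%C = modulus z.
Proof. by rewrite !modulusE; case: z => a b /=; rewrite sqrrN. Qed.

Lemma norm_Re_le z : `|complex.Re z| <= modulus z.
Proof. by rewrite modulusE -sqrtr_sqr ler_sqrt ?lerDl ?addr_ge0 ?sqr_ge0. Qed.

Lemma norm_Im_le z : `|complex.Im z| <= modulus z.
Proof. by rewrite modulusE -sqrtr_sqr ler_sqrt ?lerDr ?addr_ge0 ?sqr_ge0. Qed.

Lemma Re_le_modulus z : complex.Re z <= modulus z.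
Proof. exact: le_trans (ler_norm _) (norm_Re_le _). Qed.

Lemma modulus_le_ReIm z : modulus z <= `|complex.Re z| + `|complex.Im z|.
Proof.
rewrite -(@ler_pXn2r _ 2)// ?nnegrE ?addr_ge0 ?modulus_ge0//.
rewrite sqr_modulus sqrrD !real_normK ?num_real//.
by rewrite addrAC lerDl mulrn_wge0// mulr_ge0.
Qed.

Lemma modulus_sum (I : Type) (s : seq I) (P : pred I) (F : I -> R[i]) :
  modulus (\sum_(i <- s | P i) F i) <= \sum_(i <- s | P i) modulus (F i).
Proof.
elim/big_ind2: _ => [|a b c d ab cd|//]; first by rewrite Normc.normc0.
exact: le_trans (modulusD _ _) (lerD ab cd).
Qed.

Lemma ReD x y : complex.Re (x + y) = complex.Re x + complex.Re y.
Proof. by case: x => ? ?; case: y. Qed.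
Lemma ImD x y : complex.Im (x + y) = complex.Im x + complex.Im y.
Proof. by case: x => ? ?; case: y. Qed.
Lemma ReN x : complex.Re (- x) = - complex.Re x.
Proof. by case: x. Qed.
Lemma ImN x : complex.Im (- x) = - complex.Im x.
Proof. by case: x. Qed.
Lemma ReM x y : complex.Re (x * y) =
  complex.Re x * complex.Re y - complex.Im x * complex.Im y.
Proof. by case: x => ? ?; case: y. Qed.
Lemma ImM x y : complex.Im (x * y) =
  complex.Re x * complex.Im y + complex.Im x * complex.Re y.
Proof. by case: x => ? ?; case: y. Qed.
Lemma ReV x : complex.Re x^-1 = complex.Re x / modulus x ^+ 2.
Proof. by rewrite sqr_modulus; case: x. Qed.
Lemma ImV x : complex.Im x^-1 = - complex.Im x / modulus x ^+ 2.
Proof. by rewrite sqr_modulus; case: x => a b /=; rewrite mulNr. Qed.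

Lemma complex_eq x y :
  complex.Re x = complex.Re y -> complex.Im x = complex.Im y -> x = y.
Proof. by case: x; case: y => a b c d /= -> ->. Qed.

Lemma conjcM z : z * (z^*)%C = ((modulus z ^+ 2)%:C)%C.
Proof.
by apply: complex_eq; rewrite sqr_modulus; case: z => a b /=; ring.
Qed.

Lemma circle_modulus (w : circle R) : modulus (val w) = 1.
Proof. exact/eqP/(valP w). Qed.

Lemma circle_neq0 (w : circle R) : val w != 0.
Proof. by rewrite -modulus_gt0 circle_modulus. Qed.

Lemma circle_conj (w : circle R) : ((val w)^*)%C = (val w)^-1.
Proof.
apply: (mulfI (circle_neq0 w)).
by rewrite conjcM circle_modulus expr1n mulfV// circle_neq0.
Qed.

End ModulusTheory.

Section CircleMeasurable.
Set Implicit Arguments.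
Unset Strict Implicit.
Context {R : realType}.
Local Notation mu := (@circle_measure R).
Implicit Types f g : circle R -> R[i].

(** The sigma-algebra of the circle is the image of the Borel one under [cis], so measurability is
    tested in the angle. *)
Lemma measurable_circle (d : measure_display) (Y : measurableType d)
    (F : circle R -> Y) :
  measurable_fun setT (F \o @cis R) -> measurable_fun setT F.
Proof.
move=> mF _ B mB; rewrite setTI /measurable/= /circle_measurable/=.
by rewrite /image_set_system/= ; exact: mF.
Qed.

Definition cmeasurable f :=
  measurable_fun setT (fun w => complex.Re (f w)) /\
  measurable_fun setT (fun w => complex.Im (f w)).

Lemma cmeasurable_val : cmeasurable (@circle_val R).
Proof.
split; apply: measurable_circle => /=.
  exact: continuous_measurable_fun (@continuous_cos R).
exact: continuous_measurable_fun (@continuous_sin R).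
Qed.

Lemma cmeasurable_cst (c : R[i]) : cmeasurable (fun=> c).
Proof. by split. Qed.

Lemma cmeasurableD f g : cmeasurable f -> cmeasurable g ->
  cmeasurable (fun w => f w + g w).
Proof.
move=> [mf1 mf2] [mg1 mg2]; split.
  under eq_fun do rewrite ReD; exact: measurable_funD.
under eq_fun do rewrite ImD; exact: measurable_funD.
Qed.

Lemma cmeasurableN f : cmeasurable f -> cmeasurable (fun w => - f w).
Proof.
move=> [mf1 mf2]; split.
  under eq_fun do rewrite ReN; exact: measurableT_comp.
under eq_fun do rewrite ImN; exact: measurableT_comp.
Qed.

Lemma cmeasurableB f g : cmeasurable f -> cmeasurable g ->
  cmeasurable (fun w => f w - g w).
Proof. by move=> mf mg; apply: cmeasurableD => //; exact: cmeasurableN. Qed.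

Lemma cmeasurableM f g : cmeasurable f -> cmeasurable g ->
  cmeasurable (fun w => f w * g w).
Proof.
move=> [mf1 mf2] [mg1 mg2]; split.
  under eq_fun do rewrite ReM.
  by apply: measurable_funB; apply: measurable_funM.
under eq_fun do rewrite ImM.
by apply: measurable_funD; apply: measurable_funM.
Qed.

Lemma cmeasurableX f n : cmeasurable f -> cmeasurable (fun w => f w ^+ n).
Proof.
move=> mf; elim: n => [|n IH]; first exact: cmeasurable_cst.
by under eq_fun do rewrite exprS; exact: cmeasurableM.
Qed.

Lemma measurable_modulus f : cmeasurable f ->
  measurable_fun setT (fun w => modulus (f w)).
Proof.
move=> [mf1 mf2]; under eq_fun do rewrite modulusE.
apply: measurableT_comp; last by apply: measurable_funD; exact: measurable_funX.
exact: continuous_measurable_fun (@sqrt_continuous R).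
Qed.

Lemma cmeasurableV f : cmeasurable f -> cmeasurable (fun w => (f w)^-1).
Proof.
move=> mf; have mm := measurable_modulus mf; have [mf1 mf2] := mf.
have mV : measurable_fun setT (fun w => (modulus (f w) ^+ 2)^-1).
  under eq_fun do rewrite -powR_inv1 ?sqr_ge0//.
  by apply: (@measurableT_comp _ _ _ _ _ _ (@powR R ^~ (-1)));
    [exact: measurable_powR|exact: measurable_funX].
split.
  by under eq_fun do rewrite ReV; exact: measurable_funM.
under eq_fun do rewrite ImV; apply: measurable_funM => //.
exact: measurableT_comp.
Qed.

Lemma cmeasurable_poly (Q : {poly R[i]}) : cmeasurable (fun w => Q.[val w]).
Proof.
elim/poly_ind: Q => [|Q c IH].
  by under eq_fun do rewrite horner0; exact: cmeasurable_cst.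
under eq_fun do rewrite !hornerE.
apply: cmeasurableD; last exact: cmeasurable_cst.
by apply: cmeasurableM => //; exact: cmeasurable_val.
Qed.

End CircleMeasurable.

Section CircleProbability.
Context {R : realType}.

Lemma circle_measure_setT : @circle_measure R setT = 1%E.
Proof. by rewrite /circle_measure/= /pushforward preimage_setT; exact: probability_setT. Qed.

HB.instance Definition _ := Measure_isProbability.Build _ _ _
  (@circle_measure R) circle_measure_setT.

End CircleProbability.

Lemma bounded_integrable d (T : measurableType d) (R : realType)
    (mu : {finite_measure set T -> \bar R}) (h : T -> R) (M : R) :
  measurable_fun setT h -> (forall x, `|h x| <= M) ->
  mu.-integrable setT (EFin \o h).
Proof.
move=> mh hM; apply: (@le_integrable _ _ _ _ _ _ _ (EFin \o cst M)) => //.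
- exact/measurable_EFinP.
- by move=> x _; rewrite lee_fin (le_trans (hM _))// ler_norm.
- exact: finite_measure_integrable_cst.
Qed.

(** * Integration over the circle and the mean of the powers of [w] *)

Section CircleIntegral.
Set Implicit Arguments.
Unset Strict Implicit.
Context {R : realType}.
Local Notation mu := (@circle_measure R).
Local Notation I := (@circle_integral R).
Implicit Types (f g : circle R -> R[i]) (h : circle R -> R).

Definition cintegrable f :=
  cmeasurable f /\ mu.-integrable setT (EFin \o (fun w => modulus (f w))).

Lemma cintegrable_bounded f (M : R) : cmeasurable f ->
  (forall w, modulus (f w) <= M) -> cintegrable f.
Proof.
move=> mf fM; split => //; apply: (@bounded_integrable _ _ _ _ _ M).
  exact: measurable_modulus.
by move=> w; rewrite ger0_norm ?modulus_ge0.
Qed.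

Lemma cintegrable_Re f : cintegrable f ->
  mu.-integrable setT (EFin \o (fun w => complex.Re (f w))).
Proof.
move=> [[mf _]] i; apply: le_integrable i => //.
  exact/measurable_EFinP.
by move=> w _ /=; rewrite lee_fin (le_trans (norm_Re_le _))// ler_norm.
Qed.

Lemma cintegrable_Im f : cintegrable f ->
  mu.-integrable setT (EFin \o (fun w => complex.Im (f w))).
Proof.
move=> [[_ mf]] i; apply: le_integrable i => //.
  exact/measurable_EFinP.
by move=> w _ /=; rewrite lee_fin (le_trans (norm_Im_le _))// ler_norm.
Qed.

Lemma cintegrableD f g : cintegrable f -> cintegrable g ->
  cintegrable (fun w => f w + g w).
Proof.
move=> [mf jf] [mg jg]; split; first exact: cmeasurableD.
have := integrableD measurableT jf jg; apply: le_integrable => //.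
  apply/measurable_EFinP; apply: measurable_modulus; exact: cmeasurableD.
move=> w _ /=; rewrite lee_fin !ger0_norm ?addr_ge0 ?modulus_ge0//.
exact: modulusD.
Qed.

Lemma cintegrableM f g (M : R) : cintegrable f -> cmeasurable g ->
  (forall w, modulus (g w) <= M) -> cintegrable (fun w => f w * g w).
Proof.
move=> [mf jf] mg gM; split; first exact: cmeasurableM.
have := integrableZl measurableT M jf; apply: le_integrable => //.
  apply/measurable_EFinP; apply: measurable_modulus; exact: cmeasurableM.
move=> w _ /=; rewrite lee_fin Normc.normcM ger0_norm ?mulr_ge0 ?modulus_ge0//.
apply: le_trans (ler_norm _).
by rewrite mulrC; apply: ler_wpM2r => //; exact: modulus_ge0.
Qed.

Lemma cintegrableZ (c : R[i]) f : cintegrable f -> cintegrable (fun w => c * f w).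
Proof.
move=> jf; under eq_fun do rewrite mulrC.
exact: (cintegrableM jf (cmeasurable_cst c) (fun=> lexx _)).
Qed.

Lemma cintegrableN f : cintegrable f -> cintegrable (fun w => - f w).
Proof.
by move=> /(cintegrableZ (-1)); under eq_fun do rewrite mulN1r.
Qed.

Lemma cintegrableB f g : cintegrable f -> cintegrable g ->
  cintegrable (fun w => f w - g w).
Proof. by move=> jf jg; apply: cintegrableD => //; exact: cintegrableN. Qed.

Lemma circle_integralD f g : cintegrable f -> cintegrable g ->
  I (fun w => f w + g w) = I f + I g.
Proof.
move=> jf jg; rewrite /circle_integral; apply: complex_eq => /=.
  rewrite -RintegralD ?cintegrable_Re//; try exact: cintegrable_Re.
  by apply: eq_Rintegral => w _; rewrite ReD.
rewrite -RintegralD ?cintegrable_Im//; try exact: cintegrable_Im.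
by apply: eq_Rintegral => w _; rewrite ImD.
Qed.

Lemma circle_integralZ (c : R[i]) f : cintegrable f ->
  I (fun w => c * f w) = c * I f.
Proof.
move=> jf; have [jr ji] := (cintegrable_Re jf, cintegrable_Im jf).
have jk (k : R) h : mu.-integrable setT (EFin \o h) ->
    mu.-integrable setT (EFin \o (fun w => k * h w)).
  move=> jh; exact: (integrableZl measurableT k jh).
rewrite /circle_integral; apply: complex_eq; rewrite ?ReM ?ImM /=.
  under eq_Rintegral do rewrite ReM.
  by rewrite RintegralB ?RintegralZl//; exact: jk.
under eq_Rintegral do rewrite ImM.
by rewrite RintegralD ?RintegralZl//; exact: jk.
Qed.

Lemma circle_integralN f : cintegrable f -> I (fun w => - f w) = - I f.
Proof.
move=> jf; rewrite -mulN1r -circle_integralZ//; congr circle_integral.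
by apply/funext => w; rewrite mulN1r.
Qed.

Lemma circle_integralB f g : cintegrable f -> cintegrable g ->
  I (fun w => f w - g w) = I f - I g.
Proof.
move=> jf jg; rewrite circle_integralD//; last exact: cintegrableN.
by rewrite circle_integralN.
Qed.

(** Real and imaginary parts are estimated separately, whence the factor 2. The bound serves only
    for limits and remainder terms. *)
Lemma modulus_circle_integral f : cintegrable f ->
  modulus (I f) <= 2 * \int[mu]_w modulus (f w).
Proof.
move=> jf; apply: le_trans (modulus_le_ReIm _) _ => /=.
have [_ jm] := jf; rewrite [leRHS]mulrDl !mul1r.
have [jr ji] := (cintegrable_Re jf, cintegrable_Im jf).
apply: lerD; (apply: le_trans; first exact: le_normr_Rintegral).
  apply: le_Rintegral => //; last by move=> w _; exact: norm_Re_le.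
  exact: integrable_norm.
apply: le_Rintegral => //; last by move=> w _; exact: norm_Im_le.
exact: integrable_norm.
Qed.

Lemma circle_integral_cst (c : R[i]) : I (fun=> c) = c.
Proof.
apply: complex_eq; rewrite /circle_integral/=.
  rewrite Rintegral_cst//; transitivity (complex.Re c * 1); last by rewrite mulr1.
  by congr (_ * _); rewrite [X in fine X](@circle_measure_setT R).
rewrite Rintegral_cst//; transitivity (complex.Im c * 1); last by rewrite mulr1.
by congr (_ * _); rewrite [X in fine X](@circle_measure_setT R).
Qed.

(** Fundamental theorem of calculus over one period, [F] being a primitive of [h] in the angle. *)
Lemma Rintegral_circle_derive h (F : R -> R) :
  measurable_fun setT h -> (forall w, `|h w| <= 1) ->
  continuous (h \o @cis R) ->
  (forall t : R, is_derive t 1 F (h (cis t))) -> F 0 = F (2 * pi) ->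
  \int[mu]_w h w = 0.
Proof.
move=> mh h1 ch dF F02.
have jh : mu.-integrable setT (EFin \o h) by exact: bounded_integrable h1.
(* Adding 1 makes the integrand nonnegative, as the change of variables to the angle requires. *)
suff : \int[mu]_w (1 + h w) = 1.
  rewrite RintegralD//; last exact: finite_measure_integrable_cst.
  rewrite Rintegral_cst// mul1r [X in fine X](@circle_measure_setT R) /=.
  by move=> /(canRL (addKr _)) ->; rewrite addNr.
have h0 w : 0 <= 1 + h w by have := h1 w; rewrite ler_norml; lra.
have m1h : measurable_fun setT (fun w => (1 + h w)%:E).
  by apply/measurable_EFinP; exact: measurable_funD.
have -> : \int[mu]_w (1 + h w) =
    fine (\int[uniform_prob (pi2_gt0 R)]_t (1 + h (cis t))%:E)%E.
  congr fine; etransitivity.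
    apply: (@ge0_integral_pushforward _ _ _ _ R _ _ (uniform_prob (pi2_gt0 R))
      setT (fun w => (1 + h w)%:E)); [exact: (@measurable_cis R)|by []|by []|].
    by move=> w _; rewrite lee_fin.
  by rewrite preimage_setT.
rewrite integral_uniform//=; last 2 first.
  exact: measurableT_comp m1h (@measurable_cis R).
  by move=> t; rewrite lee_fin.
rewrite subr0 (@continuous_FTC2 _ (fun t => 1 + h (cis t)) (fun t => t + F t))//.
- rewrite -EFinB -EFinM /= -F02 add0r addrK mulVf//.
  exact/lt0r_neq0/pi2_gt0.
- exact: pi2_gt0.
- apply: continuous_subspaceT => t; apply: cvgD; first exact: cvg_cst.
  exact: ch.
- have dG t : derivable (fun t => t + F t) t 1.
    by have := dF t => dFt; apply: derivableD.
  have cG : continuous (fun t => t + F t).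
    by move=> t; apply/differentiable_continuous/derivable1_diffP.
  by split => //; [apply: cvg_at_right_filter|apply: cvg_at_left_filter]; exact: cG.
- move=> t _; have := dF t => dFt; rewrite derive1E deriveD//.
  by rewrite derive_id derive_val.
Qed.

Lemma cis_expr (t : R) n :
  val (cis t) ^+ n = (cos (n%:R * t) +i* sin (n%:R * t))%C.
Proof.
elim: n => [|n IH]; first by rewrite expr0 mul0r cos0 sin0.
rewrite exprS IH -natr1 mulrDl mul1r cosD sinD.
by apply: complex_eq; rewrite /=; ring.
Qed.

Lemma circle_integral_exprS n : I (fun w => val w ^+ n.+1) = 0.
Proof.
have [mr mi] : cmeasurable (fun w : circle R => val w ^+ n.+1).
  by apply: cmeasurableX; exact: cmeasurable_val.
have le1 (w : circle R) : modulus (val w ^+ n.+1) <= 1.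
  by rewrite modulusX circle_modulus expr1n.
pose l (t : R) := n.+1%:R * t.
have dl (t : R) : is_derive t 1 l n.+1%:R.
  have := is_deriveZ n.+1%:R (is_derive_id t (1:R)); rewrite /GRing.scale/= mulr1.
  exact.
have cl : continuous l.
  by move=> t; apply/differentiable_continuous/derivable1_diffP.
have n0 : n.+1%:R != 0 :> R by rewrite pnatr_eq0.
have lp : l (2 * pi) = 0 + (pi *+ 2) *+ n.+1 :> R.
  by rewrite add0r -(mulr_natl _ n.+1) -(mulr_natl pi 2).
have l0 : l 0 = 0 by rewrite /l mulr0.
apply: complex_eq; rewrite /circle_integral/=.
- apply: (@Rintegral_circle_derive _ (fun t => n.+1%:R^-1 * sin (l t))) => //.
  + by move=> w; exact: le_trans (norm_Re_le _) (le1 w).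
  + rewrite /comp/=; under eq_fun do rewrite cis_expr/=.
    move=> t; apply: (@continuous_comp _ _ _ l cos); first exact: cl.
    exact: continuous_cos.
  + move=> t; rewrite cis_expr/=.
    have -> : cos (n.+1%:R * t) = n.+1%:R^-1 *: (cos (l t) * n.+1%:R).
      by rewrite /GRing.scale/= mulrCA mulVf// mulr1.
    apply: is_deriveZ; exact: is_derive1_comp.
  + by rewrite lp (periodicn (@sinD2pi R)) l0.
- apply: (@Rintegral_circle_derive _ (fun t => - n.+1%:R^-1 * cos (l t))) => //.
  + by move=> w; exact: le_trans (norm_Im_le _) (le1 w).
  + rewrite /comp/=; under eq_fun do rewrite cis_expr/=.
    move=> t; apply: (@continuous_comp _ _ _ l sin); first exact: cl.
    exact: continuous_sin.
  + move=> t; rewrite cis_expr/=.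
    have -> : sin (n.+1%:R * t) = - n.+1%:R^-1 *: (- sin (l t) * n.+1%:R).
      by rewrite /GRing.scale/= !mulNr mulrN opprK mulrCA mulVf// mulr1.
    apply: is_deriveZ; exact: is_derive1_comp.
  + by rewrite lp (periodicn (@cosD2pi R)) l0.
Qed.

End CircleIntegral.

(** * Multipliers of the Hardy space *)

Section Multipliers.
Set Implicit Arguments.
Unset Strict Implicit.
Context {R : realType}.
Local Notation mu := (@circle_measure R).
Local Notation I := (@circle_integral R).
Implicit Types (f g phi psi : circle R -> R[i]) (h : circle R -> R).

(* [H^1] through the vanishing of the negative Fourier coefficients; equivalent
   to [Hardy 1] by [hardy1_analytic] and [analytic_hardy1]. *)
Definition hardy1 f :=
  cintegrable f /\ forall n, I (fun w => f w * val w ^+ n.+1) = 0.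

(** Plays the role of H^oo. Stability under products is immediate in this form, and inverses and
    bounded limits of polynomials can be reached from it. *)
Definition multiplier phi :=
  [/\ cmeasurable phi, exists M : R, forall w, modulus (phi w) <= M &
      forall f, hardy1 f -> hardy1 (fun w => f w * phi w)].

Lemma cintegrable_exprn f n : cintegrable f ->
  cintegrable (fun w => f w * val w ^+ n).
Proof.
move=> jf; apply: (@cintegrableM _ _ _ 1) => //.
  by apply: cmeasurableX; exact: cmeasurable_val.
by move=> w; rewrite modulusX circle_modulus expr1n.
Qed.

Lemma hardy1D f g : hardy1 f -> hardy1 g -> hardy1 (fun w => f w + g w).
Proof.
move=> [jf f0] [jg g0]; split => [|n]; first exact: cintegrableD.
under eq_fun do rewrite mulrDl.
by rewrite circle_integralD ?f0 ?g0 ?addr0//; exact: cintegrable_exprn.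
Qed.

Lemma hardy1Z (c : R[i]) f : hardy1 f -> hardy1 (fun w => c * f w).
Proof.
move=> [jf f0]; split => [|n]; first exact: cintegrableZ.
under eq_fun do rewrite -mulrA.
by rewrite circle_integralZ ?f0 ?mulr0//; exact: cintegrable_exprn.
Qed.

Lemma multiplier_cst (c : R[i]) : multiplier (fun=> c).
Proof.
split; [exact: cmeasurable_cst|by exists (modulus c)|].
by move=> f hf; under eq_fun do rewrite mulrC; exact: hardy1Z.
Qed.

Lemma multiplier_val : multiplier (@circle_val R).
Proof.
split; [exact: cmeasurable_val|by exists 1 => w; rewrite circle_modulus|].
move=> f [jf f0]; split => [|n]; first exact: (cintegrable_exprn 1 jf).
by under eq_fun do rewrite -mulrA -exprS.
Qed.

Lemma multiplierD phi psi : multiplier phi -> multiplier psi ->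
  multiplier (fun w => phi w + psi w).
Proof.
move=> [mphi [M phiM] hphi] [mpsi [N psiN] hpsi]; split.
- exact: cmeasurableD.
- exists (M + N) => w; apply: le_trans (modulusD _ _) _; exact: lerD.
- move=> f hf; under eq_fun do rewrite mulrDr.
  by apply: hardy1D; [exact: hphi|exact: hpsi].
Qed.

Lemma multiplierM phi psi : multiplier phi -> multiplier psi ->
  multiplier (fun w => phi w * psi w).
Proof.
move=> [mphi [M phiM] hphi] [mpsi [N psiN] hpsi]; split.
- exact: cmeasurableM.
- exists (M * N) => w; rewrite Normc.normcM.
  by apply: ler_pM => //; exact: modulus_ge0.
- move=> f hf; under eq_fun do rewrite mulrA.
  by apply: hpsi; exact: hphi.
Qed.

Lemma multiplierB phi psi : multiplier phi -> multiplier psi ->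
  multiplier (fun w => phi w - psi w).
Proof.
move=> mphi mpsi; apply: multiplierD => //.
under eq_fun do rewrite -mulN1r.
by apply: multiplierM => //; exact: multiplier_cst.
Qed.

Lemma multiplierX phi n : multiplier phi -> multiplier (fun w => phi w ^+ n).
Proof.
move=> mphi; elim: n => [|n IH]; first exact: multiplier_cst.
by under eq_fun do rewrite exprS; exact: multiplierM.
Qed.

Lemma multiplier_sum (s : seq nat) (F : nat -> circle R -> R[i]) :
  (forall i, multiplier (F i)) -> multiplier (fun w => \sum_(i <- s) F i w).
Proof.
move=> mF; elim: s => [|i s IH].
  by under eq_fun do rewrite big_nil; exact: multiplier_cst.
by under eq_fun do rewrite big_cons; exact: multiplierD.
Qed.

Lemma multiplier_poly (Q : {poly R[i]}) : multiplier (fun w => Q.[val w]).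
Proof.
elim/poly_ind: Q => [|Q c IH].
  by under eq_fun do rewrite horner0; exact: multiplier_cst.
under eq_fun do rewrite !hornerE.
apply: multiplierD; last exact: multiplier_cst.
by apply: multiplierM => //; exact: multiplier_val.
Qed.

Lemma cmeasurable_cvg (F : nat -> circle R -> R[i]) f :
  (forall n, cmeasurable (F n)) ->
  (forall w, modulus (F n w - f w) @[n --> \oo] --> (0 : R)) ->
  cmeasurable f.
Proof.
move=> mF Ff; split.
- apply: (@measurable_fun_cvg _ _ _ _ (fun n w => complex.Re (F n w))).
    by move=> n; case: (mF n).
  move=> w _; apply/subr_cvg0.
  apply/norm_cvg0P; apply: squeeze_cvgr (Ff w); last exact: cvg_cst.
  apply: nearW => n; rewrite normr_ge0/= -ReN -ReD; exact: norm_Re_le.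
- apply: (@measurable_fun_cvg _ _ _ _ (fun n w => complex.Im (F n w))).
    by move=> n; case: (mF n).
  move=> w _; apply/subr_cvg0.
  apply/norm_cvg0P; apply: squeeze_cvgr (Ff w); last exact: cvg_cst.
  apply: nearW => n; rewrite normr_ge0/= -ImN -ImD; exact: norm_Im_le.
Qed.

Lemma modulus_cvg (u : nat -> R[i]) (l : R[i]) :
  modulus (u n - l) @[n --> \oo] --> (0 : R) ->
  modulus (u n) @[n --> \oo] --> modulus l.
Proof.
move=> ul; apply/subr_cvg0/norm_cvg0P; apply: squeeze_cvgr ul; last exact: cvg_cst.
apply: nearW => n; rewrite normr_ge0/= ler_norml.
have := modulusD (u n - l) l; have := modulusD (l - u n) (u n).
by rewrite !subrK modulus_distC => H1 H2; apply/andP; split; lra.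
Qed.

(** The negative Fourier coefficients of [f * F n] vanish and pass to the limit by dominated
    convergence, with [2 M |f|] dominating [|f| |F n - phi|]. *)
Lemma multiplier_cvg (F : nat -> circle R -> R[i]) phi (M : R) :
  (forall n, multiplier (F n)) -> (forall n w, modulus (F n w) <= M) ->
  cmeasurable phi -> (forall w, modulus (phi w) <= M) ->
  {ae mu, forall w, modulus (F n w - phi w) @[n --> \oo] --> (0 : R)} ->
  multiplier phi.
Proof.
move=> mF FM mphi phiM Fphi.
have mF1 n : cmeasurable (F n) by case: (mF n).
split => //; first by exists M.
move=> f hf; have [jf f0] := hf; split => [|k]; first exact: cintegrableM phiM.
have jp n : cintegrable (fun w => f w * F n w).
  exact: cintegrableM (FM n).
have jphi : cintegrable (fun w => f w * phi w) by exact: cintegrableM phiM.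
have jpk n := cintegrable_exprn k.+1 (jp n).
have jphik := cintegrable_exprn k.+1 jphi.
have z n : I (fun w => f w * F n w * val w ^+ k.+1) = 0.
  by have [_ _ H] := mF n; have [_ ->] := H _ hf.
pose h n w : R := modulus (f w) * modulus (F n w - phi w).
have le n : modulus (I (fun w => f w * phi w * val w ^+ k.+1)) <=
    2 * \int[mu]_w h n w.
  rewrite -modulusN -[X in modulus X]sub0r -{1}(z n) -circle_integralB//.
  apply: le_trans (modulus_circle_integral _) _; first exact: cintegrableB.
  rewrite ler_pM2l// le_eqVlt; apply/orP; left; apply/eqP/eq_Rintegral => w _.
  by rewrite -mulrBl Normc.normcM modulusX circle_modulus expr1n mulr1
    -mulrBr Normc.normcM.
have c0 : \int[mu]_w h n w @[n --> \oo] --> (0 : R).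
  have mh n : measurable_fun setT (h n).
    apply: measurable_funM; apply: measurable_modulus; first by case: jf.
    exact: cmeasurableB.
  have [|||||_ _] := @dominated_convergence _ _ _ mu setT measurableT
      (fun n w => (h n w)%:E) (cst 0%E) (fun w => (2 * M * modulus (f w))%:E).
  - by move=> n; apply/measurable_EFinP.
  - exact: measurable_cst.
  - apply: filterS Fphi => w Fw _; apply/fine_cvgP; split; first exact: nearW.
    by rewrite -(mulr0 (modulus (f w))); apply: cvgMl_tmp; exact: Fw.
  - by case: jf => _ /(integrableZl measurableT (2 * M)).
  - apply/aeW => w n _; rewrite /= lee_fin ger0_norm ?mulr_ge0 ?modulus_ge0//.
    rewrite /h mulrC; apply: ler_wpM2r; first exact: modulus_ge0.
    by have := modulusB (F n w) (phi w); have := FM n w; have := phiM w; lra.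
  by rewrite integral0 => /fine_cvg.
apply/Normc.eq0_normc/le_anti; rewrite modulus_ge0 andbT.
have c20 : 2 * \int[mu]_w h n w @[n --> \oo] --> (0 : R).
  by rewrite -(mulr0 2); exact: cvgMl_tmp.
by rewrite -(cvg_lim _ c20)//; apply: limr_ge; [apply/cvg_ex; eexists; exact: c20|exact: nearW].
Qed.

(* For a large constant [c], [|1 - Q / c| < 1] on the circle, and the Neumann
   series [c^-1 * \sum_i (1 - Q / c) ^+ i] of polynomials converges to [Q^-1]. *)
Lemma multiplier_inv (Q : {poly R[i]}) (d : R) : 0 < d ->
  (forall w : circle R, d <= complex.Re Q.[val w]) ->
  multiplier (fun w => Q.[val w]^-1).
Proof.
move=> d0 dQ.
have [_ [M QM] _] := multiplier_poly Q.
have Qd (w : circle R) : d <= modulus Q.[val w].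
  by apply: le_trans (dQ w) _; exact: Re_le_modulus.
have Q0 (w : circle R) : Q.[val w] != 0.
  by rewrite -modulus_gt0; exact: lt_le_trans (Qd w).
(* With this [r] one has [|Q|^2 / r < d <= Re Q], so that [|1 - Q / r|^2 = 1 - (2 Re Q - |Q|^2 / r)
   / r] is less than 1. *)
pose r : R := (M ^+ 2 + 1) / d.
have r0 : 0 < r by rewrite divr_gt0// ltr_wpDl// sqr_ge0.
pose c : R[i] := (r%:C)%C.
have c0 : c != 0 by rewrite -modulus_gt0 modulus_real gtr0_norm.
pose x (w : circle R) : R[i] := 1 - Q.[val w] / c.
have x1 w : modulus (x w) < 1.
  have cE : c^-1 = ((r^-1)%:C)%C.
    by apply: (mulfI c0); rewrite mulfV// -rmorphM/= mulfV ?gt_eqF.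
  rewrite -(@ltr_pXn2r _ 2)// ?nnegrE ?modulus_ge0// expr1n sqr_modulus.
  rewrite ReD ImD ReN ImN ReM ImM cE /= !mulr0 subr0 !add0r sqrrN.

  have := QM w; have := dQ w; have := sqr_modulus Q.[val w].
  have := modulus_ge0 Q.[val w].
  move: (modulus _) (complex.Re _) (complex.Im _) => m a b m0 mab da mM.
  have s0 : 0 < r^-1 by rewrite invr_gt0.
  have sd : r^-1 * (M ^+ 2 + 1) = d.
    by rewrite invf_div mulfVK// gt_eqF// ltr_wpDl// sqr_ge0.
  have mM2 : m ^+ 2 <= M ^+ 2 by rewrite ler_pXn2r// nnegrE// (le_trans m0).
  rewrite -subr_gt0.
  have -> : 1 - ((1 - a / r) ^+ 2 + (b / r) ^+ 2) =
    r^-1 * (2 * a - r^-1 * m ^+ 2) by rewrite mab; ring.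
  apply: mulr_gt0 => //; have : r^-1 * m ^+ 2 <= r^-1 * M ^+ 2 by rewrite ler_pM2l.
  by move: sd; rewrite mulrDr mulr1; lra.
pose F n (w : circle R) : R[i] := c^-1 * \sum_(0 <= i < n) x w ^+ i.
have FE n w : F n w = Q.[val w]^-1 - x w ^+ n * Q.[val w]^-1.
  have xQ : x w - 1 = - (Q.[val w] / c) by rewrite /x addrC addKr.
  rewrite -{1}(mul1r Q.[_]^-1) -mulrBl -[1 - _]opprB subrX1 xQ !mulNr opprK.
  by rewrite /F big_mkord; field; rewrite c0 Q0.
apply: (@multiplier_cvg F _ (2 / d)).
- move=> n; apply: multiplierM; first exact: multiplier_cst.
  apply: multiplier_sum => i; apply: multiplierX.
  apply: multiplierB; first exact: multiplier_cst.
  apply: multiplierM; first exact: multiplier_poly.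
  exact: multiplier_cst.
- move=> n w; rewrite FE -{1}(mul1r Q.[_]^-1) -mulrBl Normc.normcM Normc.normcV.
  apply: ler_pM => //; rewrite ?invr_ge0 ?modulus_ge0//; last first.
    by rewrite lef_pV2 ?posrE// (lt_le_trans d0).
  apply: le_trans (modulusB _ _) _; rewrite Normc.normc1 modulusX.
  have := @exprn_ile1 R n _ (modulus_ge0 (x w)) (ltW (x1 w)); lra.
- exact/cmeasurableV/cmeasurable_poly.
- move=> w; rewrite Normc.normcV; apply: (@le_trans _ _ d^-1).
    by rewrite lef_pV2 ?posrE// (lt_le_trans d0).
  by rewrite ler_peMl ?invr_ge0 ?(ltW d0)// ler1n.
- apply/aeW => w; under eq_fun do rewrite FE addrAC subrr sub0r modulusN Normc.normcM modulusX.
  rewrite -(mul0r (modulus Q.[val w]^-1)); apply: cvgMr_tmp; apply: cvg_expr.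
  by rewrite ger0_norm ?modulus_ge0.
Qed.

End Multipliers.

(** * Analyticity of the Poisson extension *)

Section ComplexDerivative.
Set Implicit Arguments.
Unset Strict Implicit.
Context {R : realType}.
Implicit Types (z l : R[i]) (F : R[i] -> R[i]).

(** The norm of [R[i]] is [R[i]]-valued, so the epsilon and delta of the topology are complex
    numbers. A positive complex number is real, which allows real ones and the modulus. *)
Lemma complex_derivableP F z :
  derivable (F : R[i]^o -> R[i]^o) z 1 <->
  exists l, forall e : R, 0 < e -> exists2 d : R, 0 < d &
    forall h, h != 0 -> modulus h < d ->
      modulus (h^-1 * (F (z + h) - F z) - l) < e.
Proof.
have normE (x : R[i]) : `|x| = ((modulus x)%:C)%C by rewrite normc_def modulusE.
split.
- move=> /cvg_ex[l /cvgrPdist_lt H]; exists l => e e0.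
  have /H : (0 : R[i]) < (e%:C)%C by rewrite ltcR.
  rewrite /dnbhs/= /within/= => -[d /= d0 Hd].
  have dE : d = ((complex.Re d)%:C)%C.
    by move: d0; rewrite ltcE => /andP[/eqP Id _]; apply: complex_eq.
  exists (complex.Re d); first by move: d0; rewrite {1}dE ltcR.
  move=> h h0 hd; have := Hd h; rewrite /= sub0r normrN normE dE ltcR => /(_ hd h0).
  rewrite normE ltcR modulus_distC /GRing.scale/= mulr1 [h + z]addrC.
  exact.
- move=> [l H]; apply/cvg_ex; exists l; apply/cvgrPdist_lt => e e0.
  have eE : e = ((complex.Re e)%:C)%C.
    by move: e0; rewrite ltcE => /andP[/eqP Id _]; apply: complex_eq.
  have [|d d0 Hd] := H (complex.Re e); first by move: e0; rewrite {1}eE ltcR.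
  rewrite /dnbhs/= /within/=; exists ((d%:C)%C); first by rewrite /= ltcR.
  move=> h /=; rewrite sub0r normrN normE ltcR => hd h0.
  rewrite normE eE ltcR modulus_distC /GRing.scale/= mulr1 [h + z]addrC.
  exact: Hd.
Qed.

End ComplexDerivative.

(** * Cauchy transforms and the Poisson extension *)

Section CauchyTransform.
Set Implicit Arguments.
Unset Strict Implicit.
Context {R : realType}.
Local Notation mu := (@circle_measure R).
Local Notation I := (@circle_integral R).
Implicit Types (f s : circle R -> R[i]) (u z h : R[i]).

Lemma modulus_1B u z : modulus z = 1 -> 1 - modulus u <= modulus (1 - u * z).
Proof.
move=> z1; have := modulusD (1 - u * z) (u * z).
by rewrite subrK Normc.normc1 Normc.normcM z1 mulr1 lerBlDr.
Qed.

Lemma neq0_1B u z : modulus u < 1 -> modulus z = 1 -> 1 - u * z != 0.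
Proof.
move=> u1 z1; rewrite -modulus_gt0; apply: lt_le_trans (modulus_1B u z1).
by rewrite subr_gt0.
Qed.

Lemma modulus_V1B u z : modulus u < 1 -> modulus z = 1 ->
  modulus (1 - u * z)^-1 <= (1 - modulus u)^-1.
Proof.
move=> u1 z1; rewrite Normc.normcV lef_pV2 ?posrE ?subr_gt0//.
  exact: modulus_1B.
by rewrite modulus_gt0 neq0_1B.
Qed.

Section Kernel.
Variables (f s : circle R -> R[i]).
Hypotheses (jf : cintegrable f) (ms : cmeasurable s)
  (s1 : forall w, modulus (s w) = 1).

(** With [s = w^-1] or [s = w], this is the generating function in [u] of the Fourier coefficients
    of [f] of nonnegative, respectively nonpositive, index. *)
Definition cauchy_transform u := I (fun w => f w * (1 - u * s w)^-1).

Lemma cmeasurable_V1B u : cmeasurable (fun w => (1 - u * s w)^-1).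
Proof.
apply: cmeasurableV; apply: cmeasurableB; first exact: cmeasurable_cst.
by apply: cmeasurableM => //; exact: cmeasurable_cst.
Qed.

Lemma cintegrable_cauchy u : modulus u < 1 ->
  cintegrable (fun w => f w * (1 - u * s w)^-1).
Proof.
move=> u1; apply: (cintegrableM jf (cmeasurable_V1B u)) => w.
exact: modulus_V1B (s1 w).
Qed.

(** Expanding the kernel to first order leaves exactly [h^2 s^2 / ((1 - (u + h) s) (1 - u s)^2)],
    and the restriction on [h] keeps this denominator away from zero. *)
Lemma cauchy_transform_derive u : modulus u < 1 -> exists C : R,
  forall h, modulus h <= (1 - modulus u) / 2 ->
  modulus (cauchy_transform (u + h) - cauchy_transform u -
    h * I (fun w => f w * (s w / (1 - u * s w) ^+ 2))) <= modulus h ^+ 2 * C.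
Proof.
move=> u1; pose d := 1 - modulus u; have d0 : 0 < d by rewrite subr_gt0.
(* The factors at [u + h] and at [u] are bounded by [2 / d] and [1 / d^2]; the outer 2 is that of
   [modulus_circle_integral]. *)
exists (2 * (2 / d ^+ 3 * \int[mu]_w modulus (f w))) => h hd.
have uh1 : modulus (u + h) < 1.
  by apply: le_lt_trans (modulusD _ _) _; move: hd d0; rewrite /d; lra.
have juh := cintegrable_cauchy uh1; have ju := cintegrable_cauchy u1.
have msV u' : cmeasurable (fun w => s w / (1 - u' * s w) ^+ 2).
  under eq_fun do rewrite -exprVn; apply: cmeasurableM; first exact: ms.
  by apply: cmeasurableX; exact: cmeasurable_V1B.
have j2 : cintegrable (fun w => f w * (s w / (1 - u * s w) ^+ 2)).
  apply: (@cintegrableM _ _ _ (d^-1 ^+ 2)) => // w.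
  rewrite Normc.normcM s1 mul1r -exprVn modulusX ler_pXn2r ?nnegrE ?modulus_ge0//.
    exact: modulus_V1B.
  by rewrite invr_ge0 ltW.
rewrite -circle_integralZ// -circle_integralB// -circle_integralB//; last 2 first.
  exact: cintegrableB.
  exact: cintegrableZ.
apply: le_trans (modulus_circle_integral _) _.
  by apply: cintegrableB; [exact: cintegrableB|exact: cintegrableZ].
rewrite mulrCA ler_pM2l// mulrA -RintegralZl//; last by case: jf.
apply: le_Rintegral => //.
- have [] // : cintegrable (fun w => f w / (1 - (u + h) * s w) - f w / (1 - u * s w) -
    h * (f w * (s w / (1 - u * s w) ^+ 2))).
  by apply: cintegrableB; [exact: cintegrableB|exact: cintegrableZ].
- by case: jf => _ /(integrableZl measurableT (modulus h ^+ 2 * (2 / d ^+ 3))).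
move=> w _.
have n1 := neq0_1B uh1 (s1 w); have n2 := neq0_1B u1 (s1 w).
have -> : f w / (1 - (u + h) * s w) - f w / (1 - u * s w) -
    h * (f w * (s w / (1 - u * s w) ^+ 2)) =
  f w * (h ^+ 2 * (s w ^+ 2 * ((1 - (u + h) * s w)^-1 * (1 - u * s w)^-1 ^+ 2))).
  by field; rewrite n1 n2.
rewrite !(Normc.normcM, modulusX) s1 expr1n mul1r mulrC.
apply: ler_wpM2r; first exact: modulus_ge0.
apply: ler_wpM2l; first by rewrite sqr_ge0.
have -> : 2 / d ^+ 3 = (d / 2)^-1 * d^-1 ^+ 2 by field; rewrite gt_eqF.
apply: ler_pM; rewrite ?sqr_ge0 ?modulus_ge0//.
  apply: le_trans (modulus_V1B uh1 (s1 w)) _.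
  rewrite lef_pV2 ?posrE ?subr_gt0 ?divr_gt0//.
  by have := modulusD u h; move: hd; rewrite /d; lra.
rewrite -expr2 ler_pXn2r ?nnegrE ?modulus_ge0 ?invr_ge0 ?(ltW d0)//.
exact: modulus_V1B.
Qed.

End Kernel.

Lemma cmeasurable_valV : cmeasurable (fun w : circle R => (val w)^-1).
Proof. by apply: cmeasurableV; exact: cmeasurable_val. Qed.

Lemma modulus_valV (w : circle R) : modulus (val w)^-1 = 1.
Proof. by rewrite Normc.normcV circle_modulus invr1. Qed.

(** The geometric series in [z w^-1] plus its conjugate, the common constant term being counted
    once. *)
Lemma poisson_kernelE z (w : circle R) : modulus z < 1 ->
  ((poisson_kernel z w)%:C)%C =
  (1 - z * (val w)^-1)^-1 + (1 - (z^*)%C * val w)^-1 - 1.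
Proof.
move=> z1; have w0 := circle_neq0 w.
have n1 := neq0_1B z1 (modulus_valV w).
have n2 : 1 - (z^*)%C * val w != 0.
  by apply: neq0_1B; rewrite ?circle_modulus ?modulus_conj.
have n3 : val w - z != 0.
  rewrite (_ : _ - _ = val w * (1 - z * (val w)^-1)) ?mulf_neq0//.
  by field.
rewrite /poisson_kernel rmorphM/= rmorphB rmorph1 fmorphV/= -!conjcM.
rewrite rmorphB/= circle_conj.
have n4 : (val w)^-1 - (z^*)%C != 0.
  rewrite (_ : _ - _ = (val w)^-1 * (1 - (z^*)%C * val w)) ?mulf_neq0 ?invr_eq0//.
  by field.
by rewrite /= in w0 n2 n3 n4 *; field; rewrite w0 n2 n3.
Qed.

Lemma poisson_extensionE f z : cintegrable f -> modulus z < 1 ->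
  poisson_extension f z = cauchy_transform f (fun w => (val w)^-1) z +
    cauchy_transform f val (z^*)%C - I f.
Proof.
move=> jf z1; have zb1 : modulus (z^*)%C < 1 by rewrite modulus_conj.
have j1 := cintegrable_cauchy jf cmeasurable_valV modulus_valV z1.
have j2 := cintegrable_cauchy jf cmeasurable_val (@circle_modulus R) zb1.
rewrite /cauchy_transform -circle_integralD// -circle_integralB//.
  by congr circle_integral; apply/funext => w; rewrite poisson_kernelE//; ring.
exact: cintegrableD.
Qed.

(** The antianalytic part reduces to the mean of [f]: the kernel [(1 - z^* w)^-1 - 1] equals
    [z^* w (1 - z^* w)^-1], and [f (1 - z^* w)^-1] is again in [hardy1], so its integral against [w]
    vanishes. *)
Lemma hardy1_poisson f z : hardy1 f -> modulus z < 1 ->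
  poisson_extension f z = cauchy_transform f (fun w => (val w)^-1) z.
Proof.
move=> hf z1; have [jf f0] := hf; rewrite poisson_extensionE//.
have zb1 : modulus (z^*)%C < 1 by rewrite modulus_conj.
rewrite -[RHS]addr0 -addrA; congr (_ + _).
have j2 := cintegrable_cauchy jf cmeasurable_val (@circle_modulus R) zb1.
rewrite /cauchy_transform -circle_integralB//.
have [_ _ H] : multiplier (fun w : circle R => (1 - (z^*)%C * val w)^-1).
  have QE (w : circle R) : (1 - (z^*)%C *: 'X).[val w] = 1 - (z^*)%C * val w.
    by rewrite !hornerE.
  under eq_fun do rewrite -QE.
  apply: (@multiplier_inv _ _ (1 - modulus z)); first by rewrite subr_gt0.
  move=> w; rewrite QE ReD ReN/= lerD2l lerN2.
  apply: le_trans (Re_le_modulus _) _.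
  by rewrite Normc.normcM circle_modulus mulr1 modulus_conj.
have [jg g0] := H _ hf.
rewrite -(mulr0 (z^*)%C) -(g0 0) -circle_integralZ; last exact: cintegrable_exprn.
congr circle_integral; apply/funext => w.
have n2 : 1 - (z^*)%C * val w != 0 by apply: neq0_1B; rewrite ?circle_modulus.
by field.
Qed.

Lemma hardy1_analytic f : hardy1 f -> analytic_on_disk (poisson_extension f).
Proof.
move=> hf z z1; apply/complex_derivableP; have [jf _] := hf.
have [C HC] := cauchy_transform_derive jf cmeasurable_valV modulus_valV z1.
set D := I _ in HC; exists D => e e0.
(* The first bound is the range of the Taylor estimate; the second brings its remainder, divided by
   [|h|], below [e]. *)
pose d := Num.min ((1 - modulus z) / 2) (e / (`|C| + 1)).
have C0 : 0 < `|C| + 1 by rewrite ltr_wpDl.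
exists d; first by rewrite lt_min !divr_gt0// subr_gt0.
move=> h h0; rewrite lt_min => /andP[hz he].
have zh1 : modulus (z + h) < 1.
  by apply: le_lt_trans (modulusD _ _) _; move: hz z1; lra.
rewrite !hardy1_poisson//.
rewrite (_ : _ - D = h^-1 * (cauchy_transform f (fun w => (val w)^-1) (z + h) -
  cauchy_transform f (fun w => (val w)^-1) z - h * D)); last by field.
have hm : 0 < modulus h by rewrite modulus_gt0.
rewrite Normc.normcM Normc.normcV mulrC ltr_pdivrMr//.
apply: le_lt_trans (HC _ (ltW hz)) _.
move: he; rewrite ltr_pdivlMr// => he.
rewrite expr2 -mulrA [ltRHS]mulrC ltr_pM2l//.
apply: le_lt_trans he; apply: ler_wpM2l; first exact: modulus_ge0.
by apply: le_trans (ler_norm _) _; rewrite lerDl.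
Qed.

End CauchyTransform.

(** * From an analytic Poisson extension to vanishing Fourier coefficients *)

Section AnalyticMoments.
Set Implicit Arguments.
Unset Strict Implicit.
Context {R : realType}.
Local Notation mu := (@circle_measure R).
Local Notation I := (@circle_integral R).
Implicit Types (f : circle R -> R[i]) (u z h : R[i]).

Lemma modulus_eq0_small (x : R[i]) :
  (forall e : R, 0 < e -> modulus x <= e) -> x = 0.
Proof.
move=> H; apply/Normc.eq0_normc/le_anti; rewrite modulus_ge0 andbT.
by apply/ler_addgt0Pr => e e0; rewrite add0r; exact: H.
Qed.

(* The Poisson extension is [A z + B (conj z)] with [A], [B] analytic; comparing
   the difference quotients for real and imaginary increments gives [B' = 0]. *)
Lemma analytic_antiholomorphic_derive f z : cintegrable f ->
  analytic_on_disk (poisson_extension f) -> modulus z < 1 ->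
  I (fun w => f w * (val w / (1 - (z^*)%C * val w) ^+ 2)) = 0.
Proof.
move=> jf af z1; have zb1 : modulus (z^*)%C < 1 by rewrite modulus_conj.
have [C1 HC1] := cauchy_transform_derive jf cmeasurable_valV modulus_valV z1.
have [C2 HC2] := cauchy_transform_derive jf cmeasurable_val (@circle_modulus R) zb1.
move: HC1 HC2; set D1 := I _; set D := I _ => HC1 HC2.
have /complex_derivableP[l Hl] := af z z1.
pose A := cauchy_transform f (fun w => (val w)^-1).
pose B := cauchy_transform f val.
apply: modulus_eq0_small => e e0.
have [d d0 Hd] := Hl _ (divr_gt0 e0 (ltr0Sn R 3)).
pose C := `|C1| + `|C2| + 1; have C0 : 0 < C by rewrite ltr_wpDl.
pose t := Num.min (d / 2) (Num.min ((1 - modulus z) / 2) (e / 4 / C)).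
have t0 : 0 < t by rewrite !lt_min !divr_gt0// subr_gt0.
have [td tz te] : [/\ t < d, t <= (1 - modulus z) / 2 & t * C <= e / 4].
  split.
  - by apply: (@le_lt_trans _ _ (d / 2)); [rewrite ge_min lexx|rewrite ltr_pdivrMr// ltr_pMr// ltr1n].
  - by rewrite !ge_min lexx !orbT.
  - by rewrite -ler_pdivlMr// !ge_min lexx !orbT.
(* Up to the two Taylor remainders, the difference quotient at [h] is [D1 + (h^* / h) D]. *)
have key h : modulus h = t ->
    modulus (D1 + (h^*)%C / h * D - l) <= e / 2.
  move=> ht; have h0 : h != 0 by rewrite -modulus_gt0 ht.
  have zh1 : modulus (z + h) < 1.
    by apply: le_lt_trans (modulusD _ _) _; rewrite ht; move: tz z1; lra.
  have := Hd _ h0; rewrite ht => /(_ td).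
  rewrite !poisson_extensionE// -/A -/B rmorphD/=.
  have := HC1 h; rewrite ht -/A => /(_ tz).
  have := HC2 (h^*)%C; rewrite !modulus_conj ht -/B => /(_ tz).
  move: (A _) (A _) (B _) (B _) (I f) => a a' b b' c Hb Ha Hl1.
  have -> : D1 + (h^*)%C / h * D - l = (h^-1 * (a' + b' - c - (a + b - c)) - l) -
    h^-1 * (a' - a - h * D1) - h^-1 * (b' - b - (h^*)%C * D) by field.
  apply: le_trans (modulusB _ _) _.
  have le1 : modulus (h^-1 * (b' - b - (h^*)%C * D)) <= t * `|C2|.
    rewrite Normc.normcM Normc.normcV ht mulrC ler_pdivrMr//.
    apply: le_trans Hb _; rewrite expr2 -mulrA [leRHS]mulrAC -[leRHS]mulrA.
    by rewrite !ler_pM2l// ler_norm.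
  have le2 : modulus (h^-1 * (a' - a - h * D1)) <= t * `|C1|.
    rewrite Normc.normcM Normc.normcV ht mulrC ler_pdivrMr//.
    apply: le_trans Ha _; rewrite expr2 -mulrA [leRHS]mulrAC -[leRHS]mulrA.
    by rewrite !ler_pM2l// ler_norm.
  have := modulusB (h^-1 * (a' + b' - c - (a + b - c)) - l) (h^-1 * (a' - a - h * D1)).
  by move: te; rewrite /C mulrDr mulr1 mulrDr; move: le1 le2 Hl1 t0; lra.
(* The ratio [h^* / h] is 1 for [h = t] and -1 for [h = i t], so subtracting the two estimates
   isolates [2 D]. *)
have k1 := key ((t%:C)%C); have k2 := key ((0 +i* t)%C).
have tC0 : (t%:C)%C != 0 by rewrite -modulus_gt0 modulus_real gtr0_norm.
have := k1; rewrite modulus_real gtr0_norm// conjc_real divff// mul1r => /(_ erefl) {}k1.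
have tE : (0 +i* t)%C = 'i%C * (t%:C)%C by apply: complex_eq => /=; ring.
have i0 : 'i%C != 0 :> R[i] by rewrite eq_complex /= oner_eq0 andbF.
have ti0 : (0 +i* t)%C != 0 by rewrite tE mulf_neq0.
have k3 : ((0 +i* t)^*)%C / (0 +i* t)%C = -1.
  rewrite (_ : ((0 +i* t)^*)%C = - (0 +i* t)%C) ?mulNr ?divff//.
  by apply: complex_eq; rewrite /= ?oppr0.
have ti : modulus (0 +i* t)%C = t.
  by rewrite modulusE /= expr0n add0r sqrtr_sqr gtr0_norm.
have := k2 ti; rewrite k3 mulN1r => {}k2.
have := modulusB (D1 + D - l) (D1 - D - l).
have -> : D1 + D - l - (D1 - D - l) = 2%:R * D by ring.
rewrite Normc.normcM (_ : 2%:R = ((2 : R)%:C)%C :> R[i]); last by rewrite rmorphMn.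
by rewrite modulus_real ger0_norm//; move: k1 k2; lra.
Qed.

(** The power series of [B'] has coefficients [m * I (f w^m)] and vanishes on the disk. They are
    stripped off one at a time, with a division by [u] at each stage. *)
Lemma analytic_hardy1 f : cintegrable f ->
  analytic_on_disk (poisson_extension f) -> hardy1 f.
Proof.
move=> jf af; split => //.
(* [k n] is the tail [\sum_(m > n) m * u ^+ (m - n - 1) * w ^+ m] of the power
   series of [B'], so that its leading coefficient is read off at [u -> 0]. *)
pose k n u (w : circle R) : R[i] :=
  val w ^+ n.+1 * ((n.+1%:R - n%:R * (u * val w)) * ((1 - u * val w)^-1 ^+ 2)).
have mk n u : cmeasurable (k n u).
  apply: cmeasurableM; first by apply: cmeasurableX; exact: cmeasurable_val.
  apply: cmeasurableM; last by apply/cmeasurableX/cmeasurable_V1B/cmeasurable_val.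
  apply: cmeasurableB; first exact: cmeasurable_cst.
  apply: cmeasurableM; first exact: cmeasurable_cst.
  by apply: cmeasurableM; [exact: cmeasurable_cst|exact: cmeasurable_val].
have normn n : modulus (n%:R : R[i]) = n%:R.
  have -> : n%:R = ((n%:R : R)%:C)%C :> R[i] by rewrite rmorph_nat.
  by rewrite modulus_real normr_nat.
have half u : modulus u <= 2^-1 -> modulus u < 1.
  by move/le_lt_trans; apply; rewrite invf_lt1// ltr1n.
(* On [|u| <= 1/2] the inverse of [1 - u w] has modulus at most 2, whence the factor 4 and bounds
   uniform in [u]. *)
have kM n u w : modulus u <= 2^-1 -> modulus (k n u w) <= (n.+1 + n)%:R * 4.
  move=> u2; have u1 := half _ u2.
  rewrite /k !Normc.normcM !modulusX circle_modulus expr1n mul1r.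
  apply: ler_pM; rewrite ?sqr_ge0 ?modulus_ge0//.
    apply: le_trans (modulusB _ _) _; rewrite !Normc.normcM !normn circle_modulus.
    rewrite mulr1 natrD lerD2l -[leRHS]mulr1 ler_wpM2l//; exact: ltW.
  rewrite (_ : 4 = 2 ^+ 2); last by ring.
  rewrite -expr2 ler_pXn2r ?nnegrE ?modulus_ge0//.
  apply: le_trans (modulus_V1B u1 (circle_modulus w)) _.
  by rewrite -[leRHS]invrK lef_pV2 ?posrE ?subr_gt0//; lra.
have jk n u : modulus u <= 2^-1 -> cintegrable (fun w => f w * k n u w).
  by move=> u2; apply: cintegrableM => // w; exact: kM.
(* Splits off the leading term of the tail. *)
have step n u : modulus u <= 2^-1 -> I (fun w => f w * k n u w) =
    n.+1%:R * I (fun w => f w * val w ^+ n.+1) + u * I (fun w => f w * k n.+1 u w).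
  move=> u2; have jn := cintegrable_exprn n.+1 jf.
  rewrite -(circle_integralZ _ jn) -(circle_integralZ u (jk n.+1 u u2)).
  rewrite -circle_integralD; [|exact: cintegrableZ|exact/cintegrableZ/jk].
  congr circle_integral; apply/funext => w; rewrite /k.
  have n1 := neq0_1B (half _ u2) (circle_modulus w).
  rewrite (exprS _ n.+1) -[n.+2%:R]natr1 -[n.+1%:R]natr1.
  by field.
(* If the tail integrates to zero for every small [u != 0], its leading coefficient is [- u] times a
   bounded quantity; let [u] tend to 0. *)
have moment n : (forall u, u != 0 -> modulus u <= 2^-1 ->
    I (fun w => f w * k n u w) = 0) -> I (fun w => f w * val w ^+ n.+1) = 0.
  move=> kn0; pose K : R := (n.+2 + n.+1)%:R * 4.
  pose C := 2 * (K * \int[mu]_w modulus (f w)).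
  have IC u : modulus u <= 2^-1 -> modulus (I (fun w => f w * k n.+1 u w)) <= C.
    move=> u2; have j := jk n.+1 u u2.
    apply: le_trans (modulus_circle_integral j) _; rewrite /C ler_pM2l//.
    rewrite -RintegralZl//; last by case: jf.
    apply: le_Rintegral => //; first by case: j.
      by case: jf => _ /(integrableZl measurableT K).
    move=> w _; rewrite Normc.normcM mulrC.
    by apply: ler_wpM2r; [exact: modulus_ge0|exact: kM].
  apply: modulus_eq0_small => e e0.
  pose t := Num.min (2^-1) (e / (`|C| + 1)).
  have C0 : 0 < `|C| + 1 by rewrite ltr_wpDl.
  have t0 : 0 < t by rewrite lt_min invr_gt0 ltr0Sn divr_gt0.
  have t2 : modulus (t%:C)%C <= 2^-1.
    by rewrite modulus_real gtr0_norm// ge_min lexx.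
  have u0 : (t%:C)%C != 0 by rewrite -modulus_gt0 modulus_real gtr0_norm.
  have := step n _ t2; rewrite kn0// => /esym/eqP; rewrite addr_eq0 => /eqP E.
  have := congr1 (@Normc.normc R) E; rewrite modulusN !Normc.normcM normn.
  rewrite modulus_real (gtr0_norm t0) => En.
  have le1 : modulus (I (fun w => f w * val w ^+ n.+1)) <=
     n.+1%:R * modulus (I (fun w => f w * val w ^+ n.+1)).
    by rewrite ler_peMl ?modulus_ge0// ler1n.
  apply: le_trans le1 _; rewrite En.
  have te : t * (`|C| + 1) <= e by rewrite -ler_pdivlMr// ge_min lexx orbT.
  apply: le_trans te; rewrite ler_pM2l//; apply: le_trans (IC _ t2) _.
  by apply: le_trans (ler_norm _) _; rewrite lerDl.
have main n u : u != 0 -> modulus u <= 2^-1 -> I (fun w => f w * k n u w) = 0.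
  elim: n u => [|n IH] u u0 u2.
    have := @analytic_antiholomorphic_derive f (u^*)%C jf af.
    rewrite modulus_conj conjcK => /(_ (half _ u2)) <-.
    congr circle_integral; apply/funext => w; rewrite /k mul0r subr0 expr1 mul1r.
    by rewrite exprVn.
  have := step n u u2; rewrite IH// (moment _ IH) mulr0 add0r => /esym/eqP.
  by rewrite mulf_eq0 (negbTE u0) => /eqP.
by move=> n; apply: moment => u; exact: main.
Qed.

End AnalyticMoments.

(** * Density of trigonometric polynomials *)

Section TrigPoly.
Set Implicit Arguments.
Unset Strict Implicit.
Context {R : realType}.
Implicit Types (s t : circle R -> R) (Q : {poly R[i]}).

(** Real trigonometric polynomials, recorded together with an analytic polynomial of which they are
    the real part. *)
Definition trig_poly t :=
  exists Q : {poly R[i]}, forall w, t w = complex.Re Q.[val w].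

Lemma measurable_trig_poly t : trig_poly t -> measurable_fun setT t.
Proof.
move=> [Q tQ]; have -> : t = (fun w => complex.Re Q.[val w]) by apply/funext.
by case: (cmeasurable_poly Q).
Qed.

Lemma trig_poly_cst (r : R) : trig_poly (fun=> r).
Proof. by exists ((r%:C)%C)%:P => w; rewrite hornerC. Qed.

Lemma trig_polyD s t : trig_poly s -> trig_poly t -> trig_poly (fun w => s w + t w).
Proof. by move=> [P sP] [Q tQ]; exists (P + Q) => w; rewrite hornerD ReD sP tQ. Qed.

Lemma trig_polyZ (r : R) t : trig_poly t -> trig_poly (fun w => r * t w).
Proof.
move=> [Q tQ]; exists (((r%:C)%C)%:P * Q) => w.
by rewrite hornerM hornerC ReM /= mul0r subr0 tQ.
Qed.

Lemma trig_polyN t : trig_poly t -> trig_poly (fun w => - t w).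
Proof. by move=> /(trig_polyZ (-1)); under eq_fun do rewrite mulN1r. Qed.

Lemma trig_polyB s t : trig_poly s -> trig_poly t -> trig_poly (fun w => s w - t w).
Proof. by move=> ps pt; apply: trig_polyD => //; exact: trig_polyN. Qed.

Lemma Re_conj (z : R[i]) : complex.Re (z^*)%C = complex.Re z.
Proof. by case: z. Qed.

(** Removing the constant coefficient [c] of [Q] lowers the negative power by one, and
    [Re (w^-m c) = Re (c^* w^m)] on the circle. *)
Lemma trig_poly_conj_exprM m Q :
  trig_poly (fun w => complex.Re ((val w)^-1 ^+ m * Q.[val w])).
Proof.
elim: m Q => [|m IH] Q; first by exists Q => w; rewrite mul1r.
elim/poly_ind: Q => [|Q c _].
  by exists 0 => w; rewrite !horner0 mulr0.
have pc : trig_poly (fun w => complex.Re ((val w)^-1 ^+ m.+1 * c)).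
  exists ((c^*)%C%:P * 'X^(m.+1)) => w; rewrite !hornerE -Re_conj rmorphM/=.
  by rewrite rmorphXn/= -circle_conj conjcK mulrC.
have -> : (fun w : circle R => complex.Re ((val w)^-1 ^+ m.+1 * (Q * 'X + c%:P).[val w]))
   = (fun w => complex.Re ((val w)^-1 ^+ m * Q.[val w]) +
       complex.Re ((val w)^-1 ^+ m.+1 * c)).
  apply/funext => w; rewrite -ReD !hornerE mulrDr; congr (complex.Re (_ + _)).
  rewrite exprSr -mulrA; congr (_ * _).
  by rewrite mulrC mulfK// circle_neq0.
by apply: trig_polyD => //; exact: IH.
Qed.

(** [2 Re P Re Q = Re (P Q) + Re (P^* Q)], and on the circle [P^*] is a polynomial in [w^-1]. *)
Lemma trig_polyM s t : trig_poly s -> trig_poly t -> trig_poly (fun w => s w * t w).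
Proof.
move=> [P sP] [Q tQ].
have pc (S : {poly R[i]}) :
    trig_poly (fun w => complex.Re (((S.[val w])^*)%C * Q.[val w])).
  rewrite -(coefK S) poly_def.
  have -> : (fun w : circle R => complex.Re (((\sum_(i < size S) S`_i *: 'X^i).[val w]^*)%C
      * Q.[val w])) = (fun w => \sum_(i < size S)
        complex.Re ((val w)^-1 ^+ i * (((S`_i)^*)%C%:P * Q).[val w])).
    apply/funext => w; rewrite horner_sum rmorph_sum/= mulr_suml.
    rewrite (big_morph _ (@ReD R) (erefl (complex.Re 0))); apply: eq_bigr => i _.
    rewrite !hornerE rmorphM/= rmorphXn/= -circle_conj; congr complex.Re.
    by congr (_ * _); exact: mulrC.
  elim: (index_enum _) => [|i r IH].
    by under eq_fun do rewrite big_nil; exact: trig_poly_cst.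
  under eq_fun do rewrite big_cons; apply: trig_polyD => //.
  exact: trig_poly_conj_exprM.
have -> : (fun w => s w * t w) = (fun w => 2^-1 * (complex.Re (P * Q).[val w] +
    complex.Re (((P.[val w])^*)%C * Q.[val w]))).
  apply/funext => w; rewrite sP tQ hornerM !ReM.
  by case: (P.[val w]) => a b /=; field.
by apply: trig_polyZ; apply: trig_polyD => //; exists (P * Q).
Qed.

Lemma trig_polyX t n : trig_poly t -> trig_poly (fun w => t w ^+ n).
Proof.
move=> pt; elim: n => [|n IH]; first exact: trig_poly_cst.
by under eq_fun do rewrite exprS; exact: trig_polyM.
Qed.

End TrigPoly.

Lemma bernoulli_inequality {R : realDomainType} (a : R) n :
  -1 <= a -> 1 + n%:R * a <= (1 + a) ^+ n.
Proof.
move=> a1; elim: n => [|n IH]; first by rewrite mul0r addr0 expr0.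
rewrite exprS; apply: le_trans (_ : (1 + a) * (1 + n%:R * a) <= _); last first.
  by apply: ler_wpM2l => //; lra.
rewrite -natr1 -subr_ge0.
rewrite (_ : _ - _ = n%:R * a ^+ 2); last by ring.
by rewrite mulr_ge0// sqr_ge0.
Qed.

Section BoundedConvergence.
Set Implicit Arguments.
Unset Strict Implicit.
Context d (T : measurableType d) (R : realType).
Variable mu : {finite_measure set T -> \bar R}.

Lemma Rintegral_bounded_cvg0 (h : nat -> T -> R) (M : R) :
  (forall n, measurable_fun setT (h n)) -> (forall n x, `|h n x| <= M) ->
  (forall x, h n x @[n --> \oo] --> (0 : R)) ->
  \int[mu]_x h n x @[n --> \oo] --> (0 : R).
Proof.
move=> mh hM h0.
have : (\int[mu]_x (h n x)%:E)%E @[n --> \oo] --> (\int[mu]_x (cst 0 x))%E.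
  apply: (@dominated_cvg _ _ _ mu setT measurableT _ _ (cst M%:E)) => //.
  - by move=> n; apply/measurable_EFinP.
  - by move=> x _; apply/fine_cvgP; split; [exact: nearW|exact: h0].
  - exact: finite_measure_integrable_cst.
  - by move=> n x _; rewrite /= lee_fin.
by rewrite integral0 => /fine_cvg.
Qed.

End BoundedConvergence.

(** * Approximation of indicators in the mean *)

Section Approximation.
Set Implicit Arguments.
Unset Strict Implicit.
Context {R : realType}.
Local Notation nu := (uniform_prob (pi2_gt0 R)).
Implicit Types (s t : circle R -> R) (g : R -> R).

(** Formulated on the line of angles, where the Borel sets are generated by rays. Keeping the values
    in [[0, 1]] makes products stable. *)
Definition trig_approximable g := [/\ measurable_fun setT g,
  forall x, 0 <= g x <= 1 &
  forall e : R, 0 < e -> exists t, [/\ trig_poly t, forall w, 0 <= t w <= 1 &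
    \int[nu]_x `|t (cis x) - g x| <= e]].

Let mcis t : trig_poly t -> measurable_fun setT (t \o @cis R).
Proof.
by move=> pt; apply: measurableT_comp (@measurable_cis R); exact: measurable_trig_poly.
Qed.

Let le1_dist (x y : R) : 0 <= x <= 1 -> 0 <= y <= 1 -> `|x - y| <= 1.
Proof. by rewrite ler_norml => /andP[? ?] /andP[? ?]; apply/andP; split; lra. Qed.

Let mdist g g' : measurable_fun setT g -> measurable_fun setT g' ->
  measurable_fun setT (fun x => `|g x - g' x|).
Proof. by move=> mg mg'; apply: measurableT_comp => //; exact: measurable_funB. Qed.

Let idist g g' : measurable_fun setT g -> measurable_fun setT g' ->
  (forall x, 0 <= g x <= 1) -> (forall x, 0 <= g' x <= 1) ->
  nu.-integrable setT (EFin \o (fun x => `|g x - g' x|)).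
Proof.
move=> mg mg' g1 g1'; apply: (@bounded_integrable _ _ _ _ _ 1).
  exact: mdist.
by move=> x; rewrite normr_id le1_dist.
Qed.

(** By bounded convergence a pointwise limit is a limit in the mean, so half of [e] goes to the
    choice of [n] and half to approximating [g_ n]. *)
Lemma trig_approximable_cvg (g_ : nat -> R -> R) g :
  (forall n, trig_approximable (g_ n)) ->
  (forall x, g_ n x @[n --> \oo] --> g x) -> trig_approximable g.
Proof.
move=> ag gg.
have mg_ n : measurable_fun setT (g_ n) by case: (ag n).
have g_01 n x : 0 <= g_ n x <= 1 by case: (ag n).
have mg : measurable_fun setT g.
  by apply: (measurable_fun_cvg mg_) => x _; exact: gg.
have g01 x : 0 <= g x <= 1.
  have c := gg x; rewrite -(cvg_lim _ c)//; apply/andP; split.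
    apply: limr_ge; first by apply/cvg_ex; eexists; exact: c.
    by apply: nearW => n; have /andP[] := g_01 n x.
  apply: limr_le; first by apply/cvg_ex; eexists; exact: c.
  by apply: nearW => n; have /andP[] := g_01 n x.
split => // e e0.
have : \int[nu]_x `|g_ n x - g x| @[n --> \oo] --> (0 : R).
  apply: (@Rintegral_bounded_cvg0 _ _ _ _ _ 1).
  - by move=> n; exact: mdist.
  - by move=> n x; rewrite normr_id le1_dist.
  - by move=> x; have /subr_cvg0/cvg_norm := gg x; rewrite normr0.
move=> /cvgrPdist_lt /(_ (e / 2)); rewrite divr_gt0// => /(_ isT).
move=> [n _ /(_ n (leqnn n))/=]; rewrite sub0r normrN => Hn.
have {}Hn := le_lt_trans (ler_norm _) Hn.
have [_ _ /(_ (e / 2))] := ag n; rewrite divr_gt0// => /(_ isT)[t [pt t1 tn]].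
exists t; split => //.
apply: (@le_trans _ _ (\int[nu]_x (`|t (cis x) - g_ n x| + `|g_ n x - g x|))).
  apply: le_Rintegral => //.
  - by apply: idist => //; exact: mcis.
  - apply: (@bounded_integrable _ _ _ _ _ 2).
      by apply: measurable_funD; apply: mdist => //; exact: mcis.
    move=> x; rewrite ger0_norm ?addr_ge0//.
    have := le1_dist (t1 (cis x)) (g_01 n x).
    by have := le1_dist (g_01 n x) (g01 x); lra.
  by move=> x _; apply: le_trans (ler_normD _ _); rewrite addrA subrK.
have i1 := idist (mcis pt) (mg_ n) (fun x => t1 (cis x)) (g_01 n).
rewrite RintegralD//; last exact: idist.
by move: tn Hn; lra.
Qed.

Lemma trig_approximable_trig t : trig_poly t -> (forall w, 0 <= t w <= 1) ->
  trig_approximable (t \o @cis R).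
Proof.
move=> pt t1; split => [|x|e e0]; [exact: mcis|exact: t1|].
exists t; split => //; under eq_Rintegral do rewrite subrr normr0.
by rewrite Rintegral_cst// mul0r ltW.
Qed.

Lemma trig_approximableC g : trig_approximable g ->
  trig_approximable (fun x => 1 - g x).
Proof.
move=> [mg g1 ag]; split.
- exact: measurable_funB.
- by move=> x; have /andP[? ?] := g1 x; apply/andP; split; lra.
move=> e /ag[t [pt t1 te]]; exists (fun w => 1 - t w); split.
- by apply: trig_polyB => //; exact: trig_poly_cst.
- by move=> w; have /andP[? ?] := t1 w; apply/andP; split; lra.
apply: le_trans te; rewrite le_eqVlt; apply/orP; left; apply/eqP.
apply: eq_Rintegral => x _; rewrite -normrN; congr (`|_|); ring.
Qed.

Lemma trig_approximableM g g' : trig_approximable g -> trig_approximable g' ->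
  trig_approximable (fun x => g x * g' x).
Proof.
move=> [mg g1 ag] [mg' g1' ag'].
have M01 (a b : R) : 0 <= a <= 1 -> 0 <= b <= 1 -> 0 <= a * b <= 1.
  move=> /andP[a0 a1] /andP[b0 b1]; rewrite mulr_ge0//=.
  by rewrite mulr_ile1.
split; [exact: measurable_funM|by move=> x; exact: M01|].
move=> e e0; have e20 : 0 < e / 2 by rewrite divr_gt0.
have [t [pt t1 te]] := ag _ e20; have [t' [pt' t1' te']] := ag' _ e20.
exists (fun w => t w * t' w); split.
- exact: trig_polyM.
- by move=> w; exact: M01.
have i1 := idist (mcis pt) mg (fun x => t1 (cis x)) g1.
have i2 := idist (mcis pt') mg' (fun x => t1' (cis x)) g1'.
apply: (@le_trans _ _ (\int[nu]_x (`|t (cis x) - g x| + `|t' (cis x) - g' x|))).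
  have mtt := mcis (trig_polyM pt pt').
  have mgg := measurable_funM mg mg'.
  have tt01 x : 0 <= t (cis x) * t' (cis x) <= 1 by exact: M01.
  have gg01 x : 0 <= g x * g' x <= 1 by exact: M01.
  apply: (le_Rintegral measurableT (idist mtt mgg tt01 gg01)).
    exact: (integrableD measurableT i1 i2).
  move=> x _.
  have -> : t (cis x) * t' (cis x) - g x * g' x =
    (t (cis x) - g x) * t' (cis x) + g x * (t' (cis x) - g' x) by ring.
  apply: le_trans (ler_normD _ _) _; rewrite !normrM.
  have /andP[? ?] := t1' (cis x); have /andP[? ?] := g1 x.
  by apply: lerD; [rewrite ler_piMr// ger0_norm|rewrite ler_piMl// ger0_norm].
by rewrite RintegralD//; move: te te'; lra.
Qed.

(** The polynomials [(1 - a)^(2^n)] with [a = t^n / n], [n >= 1], converge to the indicator.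
    Bernoulli's inequality bounds them below by [1 - (2 t)^n / n], which settles [2 t <= 1]; with
    [(1 - a) (1 + a) <= 1] it bounds them above by [1 / (1 + 2^n a)], which settles [2 t > 1]. *)
Lemma trig_approximable_level t : trig_poly t -> (forall w, 0 <= t w <= 1) ->
  trig_approximable (\1_[set x : R | t (cis x) <= 2^-1]).
Proof.
move=> pt t1.
(* The factor [1 / n.+1] only matters on the level set [t = 1/2], where it
   makes the approximants converge to 1 as well. *)
pose q n w := (1 - t w ^+ n.+1 / n.+1%:R) ^+ (2 ^ n.+1)%N.
have tn n w : 0 <= t w ^+ n.+1 / n.+1%:R <= 1.
  have /andP[t0 tle] := t1 w; rewrite divr_ge0 ?exprn_ge0//=.
  by rewrite ler_pdivrMr// mul1r (le_trans (exprn_ile1 _ _ _))// ler1n.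
apply: (@trig_approximable_cvg (fun n => q n \o @cis R)).
  move=> n; apply: trig_approximable_trig.
    apply: trig_polyX; apply: trig_polyB; first exact: trig_poly_cst.
    under eq_fun do rewrite mulrC; apply: trig_polyZ; exact: trig_polyX.
  move=> w; rewrite /q; move: (_ / _) (tn n w) => y /andP[y0 y1].
  by rewrite exprn_ge0 ?exprn_ile1//; lra.
move=> x; rewrite /q /= indicE.
have -> : (x \in [set x : R | t (cis x) <= 2^-1]) = (t (cis x) <= 2^-1).
  by apply/idP/idP; rewrite inE.
have /andP[t0 tle] := t1 (cis x).
move: (t (cis x)) (tn^~ (cis x)) t0 tle => y yn y0 y1.
pose a n := y ^+ n.+1 / n.+1%:R.
have aE n : (2 ^ n.+1)%:R * a n = (2 * y) ^+ n.+1 / n.+1%:R.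
  by rewrite natrX mulrA -exprMn.
have [y2|y2] := leP y 2^-1.
- rewrite /=; apply: (@squeeze_cvgr _ _ _ _ (fun n => 1 - harmonic n) (cst 1)); last 2 first.
  + rewrite -[X in _ --> X]subr0; apply: cvgB; first exact: cvg_cst.
    exact: cvg_harmonic.
  + exact: cvg_cst.
  apply: nearW => n; have /andP[an0 an1] := yn n; rewrite -/(a n).
  apply/andP; split; last by rewrite exprn_ile1//; rewrite -/(a n) in an0 an1; lra.
  have := @bernoulli_inequality R (- a n) (2 ^ n.+1).
  rewrite lerN2 an1 => /(_ isT); apply: le_trans.
  rewrite mulrN aE lerD2l lerN2 /harmonic -[leRHS]mul1r.
  apply: ler_wpM2r; first by rewrite invr_ge0.
  by apply: exprn_ile1; [rewrite mulr_ge0|rewrite -ler_pdivlMl// mulr1].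
- rewrite /=.
  (* Bernoulli applied to the square root gives quadratic growth of [(2 y)^n], which survives
     division by [n]. *)
  pose r := Num.sqrt (2 * y); have r2 : r ^+ 2 = 2 * y by rewrite sqr_sqrtr// mulr_ge0.
  have r1 : 1 < r.
    rewrite -sqrtr1 ltr_sqrt; first by rewrite -ltr_pdivrMl// mulr1.
    by lra.
  pose b := r - 1; have b0 : 0 < b by rewrite subr_gt0.
  apply: (@squeeze_cvgr _ _ _ _ (cst 0) (fun n => harmonic n * (b ^+ 2)^-1)); last 2 first.
  + exact: cvg_cst.
  + rewrite -[X in _ --> X](mul0r (b ^+ 2)^-1); apply: cvgMr_tmp; exact: cvg_harmonic.
  apply: nearW => n; have /andP[an0 an1] := yn n; rewrite -/(a n).
  rewrite -/(a n) in an0 an1.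
  have h0 : 0 <= 1 - a n by lra.
  rewrite exprn_ge0//=.
  pose N := (2 ^ n.+1)%N.
  have B : 1 + N%:R * a n <= (1 + a n) ^+ N by apply: bernoulli_inequality; lra.
  have P : (1 - a n) ^+ N * (1 + a n) ^+ N <= 1.
    rewrite -exprMn; apply: exprn_ile1; first by rewrite mulr_ge0//; lra.
    have -> : (1 - a n) * (1 + a n) = 1 - a n ^+ 2 by ring.
    by rewrite gerBl sqr_ge0.
  have S : n.+1%:R * b ^+ 2 <= N%:R * a n.
    rewrite aE ler_pdivlMr// -r2 -exprM mulnC exprM.
    have -> : n.+1%:R * b ^+ 2 * n.+1%:R = (n.+1%:R * b) ^+ 2 by ring.
    have H := @bernoulli_inequality R b n.+1.
    rewrite ler_pXn2r ?nnegrE ?exprn_ge0 ?mulr_ge0 ?(ltW b0)//; last by lra.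
    have : -1 <= b by lra.
    by move=> /H; rewrite (_ : 1 + b = r); [lra|rewrite /b; ring].
  have nb : 0 < n.+1%:R * b ^+ 2 by rewrite mulr_gt0// exprn_gt0.
  rewrite /harmonic -invfM -[leRHS]mul1r ler_pdivlMr//.
  apply: le_trans P; apply: ler_wpM2l; first exact: exprn_ge0.
  by lra.
Qed.

End Approximation.

Section BorelApproximation.
Set Implicit Arguments.
Unset Strict Implicit.
Context {R : realType}.
Local Notation nu := (uniform_prob (pi2_gt0 R)).
Implicit Types (t : circle R -> R) (g : R -> R) (A B : set R).

(** The measure [nu] lives on [[0, 2 pi]] and its endpoints are null. *)
Lemma trig_approximable_eq g g' : trig_approximable g ->
  measurable_fun setT g' -> (forall x, 0 <= g' x <= 1) ->
  {in `]0, 2 * pi[, g =1 g'} -> trig_approximable g'.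
Proof.
move=> [mg g1 ag] mg' g1' gg'; split => // e /ag[t [pt t1 te]].
exists t; split => //; apply: le_trans te; rewrite le_eqVlt; apply/orP; left.
have mt : measurable_fun setT (t \o @cis R).
  by apply: measurableT_comp (@measurable_cis R); exact: measurable_trig_poly.
have md (h : R -> R) : measurable_fun setT h -> measurable_fun setT (fun x => `|t (cis x) - h x|).
  by move=> mh; apply: measurableT_comp => //; exact: measurable_funB.
apply/eqP; congr fine.
have iE (h : R -> R) : measurable_fun setT h -> (\int[nu]_x `|t (cis x) - h x|%:E =
    ((2 * pi - 0)^-1)%:E * \int[lebesgue_measure]_(x in `[0%R, (2 * pi)%R]) `|t (cis x) - h x|%:E)%E.
  move=> mh; rewrite integral_uniform//.
  by apply/measurable_EFinP; exact: md.
rewrite !iE//; congr (_ * _)%E; apply: eq_integral_itv_bounded.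
- by apply: measurable_funTS; exact: md.
- by apply: measurable_funTS; exact: md.
- by move=> x xi; rewrite gg'.
Qed.

Lemma trig_approximable_indicC A : trig_approximable (\1_A) ->
  trig_approximable (\1_(~` A)).
Proof.
move=> /trig_approximableC; congr trig_approximable; apply/funext => x.
by rewrite !indicE in_setC; case: (x \in A); rewrite ?subrr ?subr0.
Qed.

Lemma trig_approximable_indicI A B : trig_approximable (\1_A) ->
  trig_approximable (\1_B) -> trig_approximable (\1_(A `&` B)).
Proof. by move=> a b; rewrite indicI; exact: trig_approximableM. Qed.

Lemma trig_approximable_indicU A B : trig_approximable (\1_A) ->
  trig_approximable (\1_B) -> trig_approximable (\1_(A `|` B)).
Proof.
move=> a b; rewrite -(setCK (A `|` B)) setCU; apply: trig_approximable_indicC.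
by apply: trig_approximable_indicI; exact: trig_approximable_indicC.
Qed.

Lemma trig_approximable_indic_level t : trig_poly t ->
  (forall w, -1 <= t w <= 1) -> trig_approximable (\1_[set x : R | 0 < t (cis x)]).
Proof.
move=> pt t1; rewrite (_ : [set x : R | _] =
   ~` [set x : R | (fun w => 2^-1 * (1 + t w)) (cis x) <= 2^-1]).
  apply: trig_approximable_indicC; apply: (@trig_approximable_level _ (fun w => 2^-1 * (1 + t w))).
    by apply: trig_polyZ; apply: trig_polyD => //; exact: trig_poly_cst.
  by move=> w; have /andP[? ?] := t1 w; apply/andP; split; lra.
apply/seteqP; split => x /=; first by move=> ? ?; lra.
by move=> /negP; rewrite -ltNge; lra.
Qed.

Lemma trig_approximable_halfcircle (c : R) :
  trig_approximable (\1_[set x : R | 0 < sin (x - c)]).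
Proof.
pose t (w : circle R) := complex.Re (((- sin c) -i* cos c)%C * val w).
have tE x : t (cis x) = sin (x - c).
  by rewrite /t ReM /= sinB; ring.
have pt : trig_poly t.
  by exists (((- sin c) -i* cos c)%C%:P * 'X) => w; rewrite !hornerE.
rewrite (_ : [set x : R | _] = [set x : R | 0 < t (cis x)]); last first.
  by apply/seteqP; split => x /=; rewrite tE.
apply: trig_approximable_indic_level => // w.
rewrite -ler_norml (le_trans (norm_Re_le _))// Normc.normcM circle_modulus mulr1.
by rewrite modulusE /= !sqrrN addrC cos2Dsin2 sqrtr1.
Qed.

(** Inside []0, 2 pi[] the ray is the arc from [c] to [2 pi]: the union of the half circles starting
    at [c] and at [pi] if [0 < c <= pi], their intersection if [pi < c < 2 pi]. Otherwise it is
    everything or empty. *)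
Lemma trig_approximable_ray (c : R) : trig_approximable (\1_(`]c, +oo[%classic : set R)).
Proof.
have p0 := pi_gt0 R.
have c1 g : trig_approximable g -> {in `]0, 2 * pi[, g =1 \1_(`]c, +oo[%classic : set R)} ->
    trig_approximable (\1_(`]c, +oo[%classic : set R)).
  move=> ag; apply: trig_approximable_eq => //.
    by move=> x; rewrite indicE; case: (_ \in _); rewrite lexx ler01.
have T : trig_approximable (\1_(setT : set R)).
  rewrite (_ : \1_setT = (fun=> 1) \o @cis R).
    apply: trig_approximable_trig; first exact: trig_poly_cst.
    by move=> w; rewrite lexx ler01.
  by apply/funext => x; rewrite indicT.
have eqI A : (forall x, 0 < x < 2 * pi -> (A x <-> c < x)) ->
    {in `]0, 2 * pi[, \1_A =1 (\1_(`]c, +oo[%classic : set R) : R -> R)}.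
  move=> Ac x; rewrite in_itv/= => /Ac H; rewrite !indicE.
  suff -> : (x \in A) = (x \in (`]c, +oo[%classic : set R)) by [].
  by apply/idP/idP; rewrite !inE/= in_itv/= andbT => /H.
have npi (x : R) : - pi <= x <= 0 -> sin x <= 0.
  move=> /andP[x0 xp]; rewrite -oppr_ge0 -sinN; apply: sin_ge0_pi.
  by apply/andP; split; lra.
have [c0|c0] := leP c 0.
  apply: (c1 _ T); apply: eqI => x /andP[x0 _]; split => // _.
  exact: le_lt_trans x0.
have lower := trig_approximable_halfcircle pi.
have upper := trig_approximable_halfcircle c.
have [cp|cp] := leP c pi.
  apply: (c1 _ (trig_approximable_indicU upper lower)); apply: eqI.
  move=> x /andP[x0 x2]; split => [|cx] /=.
  - by case=> /= s0; rewrite ltNge; apply/negP => xc; move: s0; apply/negP;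
      rewrite -leNgt; apply: npi; apply/andP; split; lra.
  - have [xcp|xcp] := ltP (x - c) pi.
      by left; apply: sin_gt0_pi; apply/andP; split; lra.
    by right; apply: sin_gt0_pi; apply/andP; split; lra.
have [c2|c2] := leP (2 * pi) c.
  apply: (c1 _ (trig_approximable_indicC T)); apply: eqI.
  by move=> x /andP[_ x2]; rewrite setCT; split => // cx; lra.
apply: (c1 _ (trig_approximable_indicI upper lower)); apply: eqI.
move=> x /andP[x0 x2]; split => [[/= s1 s2]|cx] /=.
- rewrite ltNge; apply/negP => xc.
  have [xp|xp] := leP x pi.
    by move: s2; apply/negP; rewrite -leNgt; apply: npi; apply/andP; split; lra.
  by move: s1; apply/negP; rewrite -leNgt; apply: npi; apply/andP; split; lra.
- by split; apply: sin_gt0_pi; apply/andP; split; lra.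
Qed.

(** The sets with approximable indicator form a sigma-algebra containing the rays; a countable union
    is the pointwise limit of finite ones. *)
Lemma trig_approximable_measurable B : measurable B -> trig_approximable (\1_B).
Proof.
pose S := [set A : set R | trig_approximable (\1_A : R -> R)].
have S0 : S set0.
  rewrite -(setCK set0) setC0; apply: trig_approximable_indicC.
  rewrite (_ : \1_setT = (fun=> 1) \o @cis R).
    apply: trig_approximable_trig; first exact: trig_poly_cst.
    by move=> w; rewrite lexx ler01.
  by apply/funext => x; rewrite indicT.
suff : (RGenOInfty.G (R:=R)).-sigma.-measurable `<=` S.
  by rewrite -RGenOInfty.measurableE; exact.
apply: smallest_sub; last first.
  by move=> _ [x ->]; exact: trig_approximable_ray.
split => //= [A SA|F SF].
  by rewrite setTD; exact: trig_approximable_indicC.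
pose G n := \bigcup_(i < n) F i.
have SG n : S (G n).
  elim: n => [|n IH]; first by rewrite /G bigcup_mkord big_ord0.
  rewrite /G bigcup_mkord big_ord_recr/= -bigcup_mkord.
  exact: (trig_approximable_indicU IH (SF n)).
apply: (trig_approximable_cvg SG) => x.
have [[n _ Fnx]|nFx] := pselect ((\bigcup_k F k) x).
  apply: cvg_near_cst.
  exists n.+1 => // m /= nm; rewrite !indicE; congr (_%:R).
  rewrite !mem_set//; first by exists n.
  by exists n.
apply: cvg_near_cst.
apply: nearW => m; rewrite !indicE; congr (_%:R).
rewrite !memNset// => -[i _ Fix]; apply: nFx; by exists i.
Qed.

End BorelApproximation.

Section CircleApproximation.
Context {R : realType}.
Local Notation mu := (@circle_measure R).

Lemma circle_indic_approx (E : set (circle R)) (e : R) : measurable E -> 0 < e ->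
  exists t, [/\ trig_poly t, forall w, 0 <= t w <= 1 &
    \int[mu]_w `|t w - \1_E w| <= e].
Proof.
move=> mE e0; have mB : measurable (@cis R @^-1` E).
  by rewrite -[X in measurable X]setTI; exact: measurable_cis.
have [_ _ /(_ _ e0)[t [pt t1 te]]] := trig_approximable_measurable mB.
exists t; split => //; apply: le_trans te; rewrite le_eqVlt; apply/orP; left.
apply/eqP; congr fine.
have mf : measurable_fun setT (fun w => `|t w - \1_E w|%:E).
  apply/measurable_EFinP; apply: measurableT_comp => //.
  apply: measurable_funB; first exact: measurable_trig_poly.
  exact: measurable_indic.
etransitivity.
  apply: (@ge0_integral_pushforward _ _ _ _ R _ _ (uniform_prob (pi2_gt0 R))
      setT (fun w => `|t w - \1_E w|%:E)); [exact: (@measurable_cis R)|by []|by []|].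
  by move=> w _; rewrite lee_fin.
by rewrite preimage_setT; apply: eq_integral => x _.
Qed.

End CircleApproximation.

(** * The analytic cutoff *)

Section AnalyticCompletion.
Set Implicit Arguments.
Unset Strict Implicit.
Context {R : realType}.
Local Notation mu := (@circle_measure R).
Local Notation I := (@circle_integral R).
Implicit Types (t : circle R -> R) (Q : {poly R[i]}).

(** Mean value property: the part of [Q] divisible by [w] integrates to zero, being a moment of a
    polynomial multiple of the function 1 of [hardy1]. *)
Lemma circle_integral_poly Q : I (fun w => Q.[val w]) = Q.[0].
Proof.
have h1 : hardy1 (fun=> 1 : R[i]).
  split; first by apply: (@cintegrable_bounded _ _ 1) => [|w]; [exact: cmeasurable_cst|rewrite Normc.normc1].
  by move=> n; under eq_fun do rewrite mul1r; exact: circle_integral_exprS.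
have cb (P : {poly R[i]}) : cintegrable (fun w : circle R => P.[val w]).
  have [mP [M PM] _] := multiplier_poly P.
  exact: cintegrable_bounded PM.
elim/poly_ind: Q => [|Q c _].
  by under eq_fun do rewrite horner0; rewrite horner0 circle_integral_cst.
rewrite hornerMXaddC mulr0 add0r -[RHS]add0r.
have -> : (fun w : circle R => (Q * 'X + c%:P).[val w]) =
    (fun w => (Q * 'X).[val w] + c) by apply/funext => w; rewrite !hornerE.
rewrite circle_integralD//; last first.
  by apply: (@cintegrable_bounded _ _ (modulus c)) => //; exact: cmeasurable_cst.
rewrite circle_integral_cst; congr (_ + _).
have [_ _ /(_ _ h1)[_ /(_ 0)]] := multiplier_poly Q.
move=> H; rewrite -[RHS]H; congr circle_integral; apply/funext => w.
by rewrite hornerM hornerX mul1r expr1.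
Qed.

Lemma trig_poly_analytic t : trig_poly t -> exists2 Q : {poly R[i]},
  complex.Im Q.[0] = 0 & forall w, t w = complex.Re Q.[val w].
Proof.
move=> [Q tQ]; exists (Q - (0 +i* complex.Im Q.[0])%C%:P).
  by rewrite hornerD hornerN hornerC ImD ImN /= subrr.
by move=> w; rewrite hornerD hornerN hornerC ReD ReN /= subr0 tQ.
Qed.

(* [Re (int Q^2) = Re (Q 0 ^ 2) >= 0] replaces Parseval's identity. *)
Lemma analytic_L2_le Q : complex.Im Q.[0] = 0 ->
  \int[mu]_w modulus Q.[val w] ^+ 2 <= 2 * \int[mu]_w complex.Re Q.[val w] ^+ 2.
Proof.
move=> Q0; have [mQ [M QM] _] := multiplier_poly Q.
have mm := measurable_modulus mQ; have [mr mi] := mQ.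
have jm : mu.-integrable setT (EFin \o (fun w => modulus Q.[val w] ^+ 2)).
  apply: (@bounded_integrable _ _ _ _ _ (M ^+ 2)); first exact: measurable_funX.
  move=> w; rewrite ger0_norm ?sqr_ge0// ler_pXn2r ?nnegrE ?modulus_ge0//.
  exact: le_trans (modulus_ge0 _) (QM w).
have jr : mu.-integrable setT (EFin \o (fun w => complex.Re Q.[val w] ^+ 2)).
  apply: le_integrable jm => //; first by apply/measurable_EFinP; exact: measurable_funX.
  move=> w _; rewrite /= lee_fin !ger0_norm ?sqr_ge0//.
  by rewrite sqr_modulus lerDl sqr_ge0.
have mean := circle_integral_poly (Q ^+ 2).
have {mean} : 0 <= \int[mu]_w (2 * complex.Re Q.[val w] ^+ 2 - modulus Q.[val w] ^+ 2).
  have := congr1 (@complex.Re R) mean; rewrite horner_exp expr2 ReM Q0 mul0r subr0 /=.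
  move=> H; apply: (@le_trans _ _ (complex.Re Q.[0] ^+ 2)); first exact: sqr_ge0.
  rewrite expr2 -H le_eqVlt; apply/orP; left; apply/eqP/eq_Rintegral => w _.
  by rewrite hornerM ReM sqr_modulus; ring.
rewrite RintegralB//; last exact: (integrableZl measurableT 2 jr).
by rewrite RintegralZl// subr_ge0.
Qed.

End AnalyticCompletion.

(** * Covering the level sets by trigonometric polynomials *)

Section Cover.
Set Implicit Arguments.
Unset Strict Implicit.
Context {R : realType}.
Local Notation mu := (@circle_measure R).

(* Greedy covering: the part [U n] of the first sets not yet covered at step [n]
   is added to [E n], and [t n] approximates the indicator of [E n `|` U n] so
   well that the new uncovered part has measure at most [D n.+1]. *)
Lemma trig_poly_cover (E : nat -> set (circle R)) (D : nat -> R) :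
  (forall j, measurable (E j)) -> (forall j, 0 < D j) ->
  D j @[j --> \oo] --> (0 : R) ->
  (forall j, (mu (E j) <= (D j)%:E)%E) ->
  exists t : nat -> circle R -> R,
    [/\ forall j, trig_poly (t j), forall j w, 0 <= t j w <= 1,
        forall j, \int[mu]_w t j w <= 3 * D j &
        {ae mu, forall w j, E j w -> exists2 i, (j <= i)%N & 2^-1 <= t i w}].
Proof.
move=> mE D0 Dc ED.
(* The approximant is fixed beforehand as a function of the set and the tolerance, because the sets
   to approximate depend on the previous approximants. *)
have /choice[T HT] : forall Ee : set (circle R) * R, exists t : circle R -> R,
    measurable Ee.1 -> 0 < Ee.2 -> [/\ trig_poly t, forall w, 0 <= t w <= 1 &
    \int[mu]_w `|t w - \1_(Ee.1) w| <= Ee.2].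
  move=> [A e] /=; have [[mA e0]|nH] := pselect (measurable A /\ 0 < e).
    by have [t Ht] := circle_indic_approx mA e0; exists t.
  by exists (fun=> 0) => mA e0; case: nH.
(* Markov's inequality at level 1/2 doubles the error: [2 * e j <= D j.+1] bounds the next uncovered
   part, while [e j <= D j / 2] and the measure of [E j] and [U j] keep the integral of [t j] below
   [3 * D j]. *)
pose e j := Num.min (D j) (D j.+1) / 2.
have e0 j : 0 < e j by rewrite divr_gt0// lt_min !D0.
pose step j (A : set (circle R)) :=
  (E j `|` A) `&` [set w | T (E j `|` A, e j) w < 2^-1].
pose U n := iteri n step set0.
have HTE (A : set (circle R)) r : measurable A -> 0 < r -> [/\ trig_poly (T (A, r)), forall w, 0 <= T (A, r) w <= 1 &
    \int[mu]_w `|T (A, r) w - \1_A w| <= r] by move=> mA r0; exact: (HT (A, r)).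
have mU n : measurable (U n).
  elim: n => [|n IH]; first exact: measurable0.
  have mEU := measurableU _ _ (mE n) IH.
  have [pt _ _] := HTE _ _ mEU (e0 n).
  apply: measurableI => //; rewrite -[X in measurable X]setTI.
  have := measurable_trig_poly pt measurableT (measurable_itv `]-oo, 2^-1[).
  by rewrite set_itvE.
pose S n := E n `|` U n.
have mS n : measurable (S n) by exact: measurableU.
pose t n := T (S n, e n).
have Ht n := HTE _ _ (mS n) (e0 n).
have pt n : trig_poly (t n) by case: (Ht n).
have t01 n w : 0 <= t n w <= 1 by have [_ H _] := Ht n; exact: H.
have mt n := measurable_trig_poly (pt n).
have te n : \int[mu]_w `|t n w - \1_(S n) w| <= e n by case: (Ht n).
have mi (A : set (circle R)) : measurable A ->
    measurable_fun setT (\1_A : circle R -> R) by exact: measurable_indic.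
have i01 (A : set (circle R)) w : 0 <= (\1_A w : R) <= 1.
  by rewrite indicE; case: (_ \in _); rewrite lexx ler01.
have ji (A : set (circle R)) : measurable A -> mu.-integrable setT (EFin \o (\1_A : circle R -> R)).
  move=> mA; apply: (@bounded_integrable _ _ _ _ _ 1); first exact: mi.
  by move=> w; have /andP[? ?] := i01 A w; rewrite ger0_norm.
have jt n : mu.-integrable setT (EFin \o t n).
  apply: (@bounded_integrable _ _ _ _ _ 1) => // w.
  by have /andP[? ?] := t01 n w; rewrite ger0_norm.
have jd n : mu.-integrable setT (EFin \o (fun w => `|t n w - \1_(S n) w|)).
  have := integrable_norm (integrableB measurableT (jt n) (ji _ (mS n))).
  exact.
have ii (A : set (circle R)) : measurable A -> (\int[mu]_w \1_A w)%:E = mu A.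
  move=> mA; rewrite /Rintegral integral_indic// setIT fineK//.
  exact: fin_num_measure.
(* On [U n.+1] the approximant is below 1/2 while the indicator is 1. *)
have UD n : (mu (U n) <= (D n)%:E)%E.
  case: n => [|n]; first by rewrite /= measure0 lee_fin ltW.
  rewrite -ii// lee_fin; apply: (@le_trans _ _ (2 * e n)); last first.
    by rewrite /e mulrC divfK ?ge_min ?lexx ?orbT// pnatr_eq0.
  apply: le_trans (_ : 2 * \int[mu]_w `|t n w - \1_(S n) w| <= _); last first.
    by rewrite ler_pM2l.
  rewrite -RintegralZl//; apply: le_Rintegral => //; first exact: ji.
    exact: (integrableZl measurableT 2 (jd n)).
  move=> w _; rewrite indicE.
  case: (boolP (w \in U n.+1)) => [|_]; last by rewrite mulr_ge0.
  rewrite inE /= => -[Sw tw]; rewrite indicE mem_set//= distrC.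
  have := ler_norm (1%:R - t n w); have {}tw : t n w < 2^-1 by exact: tw.
  lra.
exists t; split => //.
- move=> j; apply: (@le_trans _ _ (\int[mu]_w (`|t j w - \1_(S j) w| + \1_(S j) w))).
    apply: le_Rintegral => //.
      exact: (integrableD measurableT (jd j) (ji _ (mS j))).
    by move=> w _; rewrite -lerBlDr ler_norm.
  rewrite RintegralD//; last exact: ji.
  have : \int[mu]_w \1_(S j) w <= D j + D j.
    rewrite -lee_fin ii// EFinD; apply: le_trans (measureU2 _ _ _) _ => //.
    by apply: leeD; [exact: ED|exact: UD].
  have : e j <= D j / 2 by rewrite ler_pM2r// ge_min lexx.
  by have := te j; have := D0 j; lra.
(* These points lie in [U i.+1] for all [i >= j], sets whose measure tends to 0. *)
have neg j : mu.-negligible (\bigcap_(i in [set i | (j <= i)%N]) U i.+1).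
  exists (\bigcap_(i in [set i | (j <= i)%N]) U i.+1); split => //.
    by apply: bigcap_measurable => [|k _]; [exists j => /=|exact: mU].
  apply/eqP; rewrite eq_le measure_ge0 andbT.
  apply/lee_addgt0Pr => r r0; rewrite add0e.
  move/cvgrPdist_lt : Dc => /(_ _ r0)[N _ HN].
  pose i := maxn j N.
  apply: (@le_trans _ _ (mu (U i.+1))).
    apply: le_measure; rewrite ?inE//; last by move=> w; apply; rewrite /= leq_maxl.
    by apply: bigcap_measurable => [|k _]; [exists j => /=|exact: mU].
  apply: le_trans (UD _) _; rewrite lee_fin ltW//.
  have /= := HN i.+1 (leqW (leq_maxr _ _)).
  by rewrite sub0r normrN gtr0_norm.
have : mu.-negligible (\bigcup_j \bigcap_(i in [set i | (j <= i)%N]) U i.+1).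
  exact: negligible_bigcup.
apply: negligibleS => w /= /existsNP[j /not_implyP[Ej nt]].
(* A point of [E j] at which every later [t i] is below 1/2 is passed on from [U i] to [U i.+1]
   forever. *)
have H i : (j <= i)%N -> (S i) w -> (U i.+1) w.
  move=> jlei Si; split => //=; rewrite ltNge; apply/negP => ti.
  by apply: nt; exists i.
exists j => // i /= jlei; apply: (H _ jlei); rewrite -(subnKC jlei).
elim: (i - j)%N => [|k IH]; first by rewrite addn0; left.
by rewrite addnS; right; apply: H => //; rewrite leq_addr.
Qed.

End Cover.

Section Series.
Set Implicit Arguments.
Unset Strict Implicit.
Context {R : realType}.

Lemma complex_series_cvg (u : nat -> R[i]) (M : R) :
  (forall n, \sum_(0 <= j < n) modulus (u j) <= M) ->
  exists l, modulus (\sum_(0 <= j < n) u j - l) @[n --> \oo] --> (0 : R).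
Proof.
move=> uM.
have cv (v : nat -> R) : (forall j, `|v j| <= modulus (u j)) -> cvgn (series v).
  move=> vu; apply: normed_cvg.
  rewrite (_ : [normed series v] = series (fun k => `|v k|))//.
  apply: nondecreasing_is_cvgn.
    by apply/nondecreasing_seqP => n; rewrite seriesSr lerDl.
  exists M => _ [n _ <-]; apply: le_trans (uM n); rewrite /series/=.
  by apply: ler_sum => j _; exact: vu.
have /cvg_ex[a ha] := cv _ (fun j => norm_Re_le (u j)).
have /cvg_ex[b hb] := cv _ (fun j => norm_Im_le (u j)).
exists (a +i* b)%C.
have ReS n : complex.Re (\sum_(0 <= j < n) u j) = series (fun j => complex.Re (u j)) n.
  by rewrite (big_morph _ (@ReD R) (erefl (complex.Re 0))).
have ImS n : complex.Im (\sum_(0 <= j < n) u j) = series (fun j => complex.Im (u j)) n.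
  by rewrite (big_morph _ (@ImD R) (erefl (complex.Im 0))).
have Z : `|series (fun j => complex.Re (u j)) n - a| +
    `|series (fun j => complex.Im (u j)) n - b| @[n --> \oo] --> (0 : R).
  rewrite -[X in _ --> X]addr0; apply: cvgD.
    by have /subr_cvg0/cvg_norm := ha; rewrite normr0.
  by have /subr_cvg0/cvg_norm := hb; rewrite normr0.
apply: (@squeeze_cvgr _ _ _ _ (cst 0) _ _ _ _ _ Z); last exact: cvg_cst.
apply: nearW => n; rewrite modulus_ge0/= (le_trans (modulus_le_ReIm _))//.
by rewrite ReD ImD ReN ImN ReS ImS.
Qed.

Lemma weighted_cauchy_schwarz (a x : nat -> R) n :
  (forall j, 0 <= a j) -> (forall j, 0 <= x j) ->
  (\sum_(0 <= j < n) a j * x j) ^+ 2 <=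
  (\sum_(0 <= j < n) a j) * \sum_(0 <= j < n) a j * x j ^+ 2.
Proof.
move=> a0 x0; elim: n => [|n IH]; first by rewrite !big_nil expr0n mulr0.
rewrite !big_nat_recr//=.
have A0 : 0 <= \sum_(0 <= j < n) a j by exact: sumr_ge0.
have B0 : 0 <= \sum_(0 <= j < n) a j * x j ^+ 2.
  by apply: sumr_ge0 => j _; rewrite mulr_ge0// sqr_ge0.
have S0 : 0 <= \sum_(0 <= j < n) a j * x j.
  by apply: sumr_ge0 => j _; rewrite mulr_ge0.
move: (\sum_(0 <= j < n) a j) (\sum_(0 <= j < n) a j * x j ^+ 2)
  (\sum_(0 <= j < n) a j * x j) (a n) (x n) (a0 n) (x0 n) A0 B0 S0 IH.
move=> A B S b y b0 y0 A0 B0 S0 IH.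
(* Arithmetic-geometric mean inequality for [A y^2] and [B], with [S^2 <= A B] from the
   induction. *)
have key : 2 * (S * y) <= A * y ^+ 2 + B.
  rewrite -(@ler_pXn2r _ 2)// ?nnegrE ?addr_ge0 ?mulr_ge0 ?sqr_ge0//.
  apply: (@le_trans _ _ (4 * (A * y ^+ 2) * B)).
    rewrite (_ : (2 * (S * y)) ^+ 2 = 4 * y ^+ 2 * S ^+ 2); last by ring.
    rewrite (_ : 4 * (A * y ^+ 2) * B = 4 * y ^+ 2 * (A * B)); last by ring.
    by apply: ler_wpM2l => //; rewrite mulr_ge0 ?sqr_ge0.
  rewrite -subr_ge0 (_ : _ - _ = (A * y ^+ 2 - B) ^+ 2) ?sqr_ge0//; ring.
have kb : b * (2 * (S * y)) <= b * (A * y ^+ 2 + B) by exact: ler_wpM2l.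
rewrite -subr_ge0 (_ : _ - _ = (A * B - S ^+ 2) +
  (b * (A * y ^+ 2 + B) - b * (2 * (S * y)))); last by ring.
by rewrite addr_ge0// subr_ge0.
Qed.

End Series.

(** * Construction of the bounded analytic cutoff *)

Section Cutoff.
Set Implicit Arguments.
Unset Strict Implicit.
Context {R : realType}.
Local Notation mu := (@circle_measure R).

Lemma cmeasurable_if (b : circle R -> bool) (f g : circle R -> R[i]) :
  measurable_fun setT b -> cmeasurable f -> cmeasurable g ->
  cmeasurable (fun w => if b w then f w else g w).
Proof.
move=> mb [f1 f2] [g1 g2]; split.
  under eq_fun do rewrite (fun_if (@complex.Re R)); exact: measurable_fun_ifT.
under eq_fun do rewrite (fun_if (@complex.Im R)); exact: measurable_fun_ifT.
Qed.

(* [phi] is [1 / (1 + \sum_j c j * Q j)], where [Q j] is the analytic polynomial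
   with real part [t j]; it is set to [1] on the null set where the series may
   diverge, so that the bound on [1 - phi] holds everywhere. *)
Lemma analytic_cutoff (t : nat -> circle R -> R) (c d : nat -> R) (A : R) :
  (forall j, trig_poly (t j)) -> (forall j w, 0 <= t j w <= 1) ->
  (forall j, 0 < c j) -> (forall j, 0 < d j) ->
  (forall j, \int[mu]_w t j w <= 3 * d j ^+ 2) ->
  (forall n, \sum_(0 <= j < n) c j * d j <= A) ->
  exists phi, [/\ multiplier phi, forall w, modulus (phi w) <= 1,
    {ae mu, forall w j, (1 + c j * t j w) * modulus (phi w) <= 1} &
    (\int[mu]_w (modulus (1 - phi w) ^+ 2)%:E <= (6 * A ^+ 2)%:E)%E].
Proof.
move=> pt t01 c0 d0 td cdA.
have /choice[Q HQ] : forall j, exists Q : {poly R[i]}, complex.Im Q.[0] = 0 /\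
    forall w, t j w = complex.Re Q.[val w].
  by move=> j; have [Q Q0 tQ] := trig_poly_analytic (pt j); exists Q.
pose q j (w : circle R) := (Q j).[val w].
have mq j : cmeasurable (q j) by exact: cmeasurable_poly.
(* In [c j |Q j| = a j * y j] the weights [a j] have sum at most [A] and each [y j] has mean square
   at most 6. Weighted Cauchy-Schwarz then bounds the squared modulus of the series by [A * X],
   where [X], the sum of the [a j * y j^2], has integral at most [6 * A]. *)
pose a j := c j * d j.
have a0 j : 0 < a j by rewrite mulr_gt0.
pose y j w : R := modulus (q j w) / d j.
have y0 j w : 0 <= y j w by rewrite divr_ge0 ?modulus_ge0// ltW.
have dn0 j : d j != 0 by rewrite gt_eqF.
have ay j w : modulus (((c j)%:C)%C * q j w) = a j * y j w.
  rewrite Normc.normcM modulus_real gtr0_norm// /a /y.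
  by move: (modulus _) => m; field.
pose x j (w : circle R) : R := a j * y j w ^+ 2.
have x0 j w : 0 <= x j w by rewrite mulr_ge0 ?sqr_ge0// ltW.
have mx j : measurable_fun setT (x j).
  apply: measurable_funM => //; apply: measurable_funX.
  by apply: measurable_funM => //; exact: measurable_modulus.
pose X w := (\sum_(0 <= j <oo) (x j w)%:E)%E.
have mX : measurable_fun setT X.
  by apply: ge0_emeasurable_sum => [j w _ _|j _]; [rewrite lee_fin|apply/measurable_EFinP].
have X0 w : (0 <= X w)%E by apply: nneseries_ge0 => j _ _; rewrite lee_fin.
have xX n w : ((\sum_(0 <= j < n) x j w)%:E <= X w)%E.
  by rewrite -sumEFin; apply: nneseries_lim_ge => j _ _; rewrite lee_fin.
have ix j : (\int[mu]_w (x j w)%:E <= (6 * a j)%:E)%E.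
  have [Q0 tQ] := HQ j; have [_ [M QM] _] := multiplier_poly (Q j).
  have jm : mu.-integrable setT (EFin \o (fun w => modulus (q j w) ^+ 2)).
    apply: (@bounded_integrable _ _ _ _ _ (M ^+ 2)).
      by apply: measurable_funX; exact: measurable_modulus.
    have M0 : 0 <= M by apply: le_trans (QM (cis 0)); exact: modulus_ge0.
    move=> w; rewrite ger0_norm ?sqr_ge0// ler_pXn2r ?nnegrE ?modulus_ge0//.
    exact: QM.
  have jx : mu.-integrable setT (EFin \o x j).
    have := integrableZl measurableT (a j / d j ^+ 2) jm.
    congr (_.-integrable _ _); apply/funext => w /=.
    by rewrite /x /y; congr EFin; move: (modulus _) => m; field.
  have -> : (\int[mu]_w (x j w)%:E)%E = (\int[mu]_w x j w)%:E.
    by rewrite fineK//; exact: integrable_fin_num.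
  rewrite lee_fin.
  have -> : \int[mu]_w x j w = a j / d j ^+ 2 * \int[mu]_w modulus (q j w) ^+ 2.
    rewrite -RintegralZl//; apply: eq_Rintegral => w _.
    by rewrite /x /y; move: (modulus _) => m; field.
  have jt : mu.-integrable setT (EFin \o t j).
    apply: (@bounded_integrable _ _ _ _ _ 1); first exact: measurable_trig_poly.
    by move=> w; have /andP[? ?] := t01 j w; rewrite ger0_norm.
  (* The 6 is the 2 of [analytic_L2_le] times the 3 of the covering; [0 <= t j <= 1] gives
     [(Re Q)^2 <= t j]. *)
  have le1 : \int[mu]_w modulus (q j w) ^+ 2 <= 6 * d j ^+ 2.
    apply: le_trans (analytic_L2_le Q0) _.
    apply: (@le_trans _ _ (2 * \int[mu]_w t j w)); last by have := td j; lra.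
    rewrite ler_pM2l//; apply: le_Rintegral => //.
      apply: (@bounded_integrable _ _ _ _ _ 1).
        by apply: measurable_funX; case: (mq j).
      move=> w; rewrite -tQ; have /andP[? ?] := t01 j w.
      by rewrite ger0_norm ?exprn_ge0// exprn_ile1.
    move=> w _; rewrite -tQ; have /andP[? ?] := t01 j w.
    by rewrite expr2 ler_piMr.
  apply: le_trans (_ : a j / d j ^+ 2 * (6 * d j ^+ 2) <= _).
    by rewrite ler_pM2l// divr_gt0// exprn_gt0.
  by rewrite le_eqVlt; apply/orP; left; apply/eqP; field.
have iX : (\int[mu]_w X w <= (6 * A)%:E)%E.
  rewrite integral_nneseries//; [|by move=> j; apply/measurable_EFinP|by move=> j w _; rewrite lee_fin].
  apply: lime_le; first by apply: is_cvg_nneseries => j _ _; apply: integral_ge0 => w _; rewrite lee_fin.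
  apply: nearW => n; apply: (@le_trans _ _ (\sum_(0 <= j < n) (6 * a j)%:E)%E).
    by apply: lee_sum => j _; exact: ix.
  by rewrite sumEFin lee_fin -mulr_sumr ler_pM2l.
have jX : mu.-integrable setT X.
  apply/integrableP; split => //.
  under eq_integral => w _ do rewrite gee0_abs//.
  by rewrite (le_lt_trans iX)// ltry.
have fX : {ae mu, forall w, X w \is a fin_num}.
  by apply: filterS (integrable_ae measurableT jX) => w; exact.
pose u j w := ((c j)%:C)%C * q j w.
pose Phi n w := 1 + \sum_(0 <= j < n) u j w.
have A0 : 0 <= A by have := cdA 0; rewrite big_nil.
(* By [y <= (1 + y^2) / 2], finiteness of [X w] gives absolute convergence. *)
have sums n w : X w \is a fin_num -> \sum_(0 <= j < n) modulus (u j w) <= (A + fine (X w)) / 2.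
  move=> Xw; have := xX n w; rewrite -{1}(fineK Xw) lee_fin => H.
  apply: (@le_trans _ _ (\sum_(0 <= j < n) (a j + x j w) / 2)).
    apply: ler_sum => j _; rewrite /u ay /x -subr_ge0.
    rewrite (_ : _ - _ = a j * (1 - y j w) ^+ 2 / 2); last by field.
    by rewrite divr_ge0// mulr_ge0 ?sqr_ge0// ltW.
  rewrite -mulr_suml ler_pM2r ?invr_gt0// big_split/=.
  by apply: lerD => //; exact: cdA.
have /choice[L HL] : forall w, exists l, X w \is a fin_num ->
    modulus (Phi n w - l) @[n --> \oo] --> (0 : R).
  move=> w; have [Xw|_] := boolP (X w \is a fin_num); last by exists 0.
  have [l Hl] := complex_series_cvg (fun n => sums n w Xw).
  exists (1 + l) => _; apply: cvg_trans Hl; apply: near_eq_cvg; apply: nearW => n.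
  by congr modulus; rewrite /Phi; ring.
(* All terms have nonnegative real part, so [|Phi n w|] is at least 1 and at least each single
   [1 + c i * t i w] with [i < n]. *)
have RePhi n w : complex.Re (Phi n w) = 1 + \sum_(0 <= j < n) c j * t j w.
  rewrite ReD (big_morph _ (@ReD R) (erefl (complex.Re 0))); congr (_ + _).
  apply: eq_bigr => j _; rewrite /u ReM /= mul0r subr0.
  by have [_ ->] := HQ j.
have ct0 j w : 0 <= c j * t j w.
  by have /andP[? _] := t01 j w; rewrite mulr_ge0// ltW.
have RePhi1 n w : 1 <= complex.Re (Phi n w).
  by rewrite RePhi lerDl sumr_ge0.
have Phit i n w : (i < n)%N -> 1 + c i * t i w <= modulus (Phi n w).
  move=> lin; apply: le_trans (Re_le_modulus _); rewrite RePhi lerD2l.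
  rewrite big_mkord (bigD1 (Ordinal lin))//= lerDl sumr_ge0// => *; exact: ct0.
have Phi1 n w : 1 <= modulus (Phi n w).
  by apply: le_trans (RePhi1 n w) (Re_le_modulus _).
have Lt w : X w \is a fin_num -> forall i, 1 + c i * t i w <= modulus (L w).
  move=> Xw i; have cL := modulus_cvg (HL w Xw).
  rewrite -(cvg_lim _ cL)//; apply: limr_ge; first by apply/cvg_ex; eexists; exact: cL.
  by exists i.+1 => // n /= lin; exact: Phit.
have L1 w : X w \is a fin_num -> 1 <= modulus (L w).
  by move=> Xw; apply: le_trans (Lt w Xw 0%N); rewrite lerDl.
pose fin w := X w \is a fin_num.
have mfin : measurable_fun setT fin.
  by apply: (@measurable_fun_bool _ _ _ _ true); apply: emeasurable_fin_num.
(* Inversion does not increase distances between numbers of modulus at least 1. *)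
have diffV n w : X w \is a fin_num ->
    modulus ((Phi n w)^-1 - (L w)^-1) <= modulus (Phi n w - L w).
  move=> Xw; have P1 := Phi1 n w; have M1 := L1 w Xw.
  have P0 : Phi n w != 0 by rewrite -modulus_gt0; exact: lt_le_trans P1.
  have M0 : L w != 0 by rewrite -modulus_gt0; exact: lt_le_trans M1.
  rewrite (_ : _ - _ = (L w - Phi n w) * ((Phi n w)^-1 * (L w)^-1)); last first.
    by field; rewrite P0 M0.
  rewrite Normc.normcM (modulus_distC (L w)) ler_piMr ?modulus_ge0//.
  by rewrite Normc.normcM !Normc.normcV mulr_ile1 ?invr_ge0 ?modulus_ge0// invf_le1
    // modulus_gt0.
have cV w : X w \is a fin_num ->
    modulus ((Phi n w)^-1 - (L w)^-1) @[n --> \oo] --> (0 : R).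
  move=> Xw; apply: (@squeeze_cvgr _ _ _ _ (cst 0) _ _ _ _ _ (HL w Xw)); last exact: cvg_cst.
  by apply: nearW => n; rewrite modulus_ge0/=; exact: diffV.
pose P n : {poly R[i]} := 1 + \sum_(0 <= j < n) ((c j)%:C)%C *: Q j.
have PE n w : (P n).[val w] = Phi n w.
  rewrite hornerD hornerC horner_sum; congr (_ + _).
  by apply: eq_bigr => j _; rewrite hornerZ.
have mPhi n : multiplier (fun w => (Phi n w)^-1).
  under eq_fun do rewrite -PE; apply: (@multiplier_inv _ _ 1) => // w.
  by rewrite PE.
have PhiV1 n w : modulus (Phi n w)^-1 <= 1.
  by rewrite Normc.normcV invf_le1// (lt_le_trans _ (Phi1 n w)).
pose phi w := if fin w then (L w)^-1 else 1.
have phi1 w : modulus (phi w) <= 1.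
  rewrite /phi; case: ifPn => [Xw|_]; last by rewrite Normc.normc1.
  by rewrite Normc.normcV invf_le1 ?L1// (lt_le_trans _ (L1 w Xw)).
have mphi : cmeasurable phi.
  apply: (@cmeasurable_cvg _ (fun n w => if fin w then (Phi n w)^-1 else 1)).
    move=> n; apply: cmeasurable_if; first exact: mfin.
      by case: (mPhi n).
    exact: cmeasurable_cst.
  move=> w; rewrite /phi; case: ifPn => [Xw|_]; first exact: cV.
  by under eq_fun do rewrite subrr Normc.normc0; exact: cvg_cst.
exists phi; split => //.
- apply: (@multiplier_cvg _ (fun n w => (Phi n w)^-1) _ 1) => //.
  by apply: filterS fX => w Xw; rewrite /phi /fin Xw; exact: cV.
- apply: filterS fX => w Xw j; rewrite /phi /fin Xw Normc.normcV.
  rewrite ler_pdivrMr; last exact: lt_le_trans (L1 w Xw).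
  by rewrite mul1r; exact: Lt.
(* Since [|L| >= 1], [|1 - phi| <= |L - 1|]; the bound [A * X] holds for the partial sums and passes
   to the limit. *)
apply: (@le_trans _ _ (\int[mu]_w (A%:E * X w))%E).
  apply: ge0_le_integral => //.
  - by move=> w _; rewrite lee_fin sqr_ge0.
  - apply/measurable_EFinP; apply: measurable_funX; apply: measurable_modulus.
    by apply: cmeasurableB => //; exact: cmeasurable_cst.
  - exact: measurable_funeM.
  move=> w _; rewrite /phi /fin; case: ifPn => [Xw|_]; last first.
    by rewrite subrr Normc.normc0 expr0n mule_ge0// lee_fin.
  have M1 := L1 w Xw; have M0 : L w != 0 by rewrite -modulus_gt0; exact: lt_le_trans M1.
  rewrite -(fineK Xw) -EFinM lee_fin.
  apply: (@le_trans _ _ (modulus (L w - 1) ^+ 2)).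
    rewrite ler_pXn2r ?nnegrE ?modulus_ge0//.
    rewrite (_ : 1 - _ = (L w - 1) * (L w)^-1); last by field.
    rewrite Normc.normcM Normc.normcV ler_piMr ?modulus_ge0//.
    by rewrite invf_le1// modulus_gt0.
  have cL : modulus (Phi n w - 1) ^+ 2 @[n --> \oo] --> modulus (L w - 1) ^+ 2.
    have : modulus (Phi n w - 1) @[n --> \oo] --> modulus (L w - 1).
      apply: modulus_cvg; apply: cvg_trans (HL w Xw); apply: near_eq_cvg.
      by apply: nearW => n; congr modulus; ring.
    by move=> H; rewrite expr2; under eq_fun do rewrite expr2; exact: cvgM.
  rewrite -(cvg_lim _ cL)//; apply: limr_le; first by apply/cvg_ex; eexists; exact: cL.
  apply: nearW => n; rewrite /Phi addrAC subrr add0r.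
  apply: (@le_trans _ _ ((\sum_(0 <= j < n) a j * y j w) ^+ 2)).
    rewrite ler_pXn2r ?nnegrE ?modulus_ge0//; last first.
      by apply: sumr_ge0 => j _; rewrite mulr_ge0// ltW.
    apply: le_trans (modulus_sum _ _ _) _; apply: ler_sum => j _.
    by rewrite /u ay.
  apply: le_trans (weighted_cauchy_schwarz _ _ _) _ => [j|j|]; [exact: ltW|exact: y0|].
  have := xX n w; rewrite -{1}(fineK Xw) lee_fin => H.
  by apply: ler_pM => //; apply: sumr_ge0 => j _; [exact: ltW|exact: x0].
rewrite ge0_integralZl_EFin//; apply: (@le_trans _ _ (A%:E * (6 * A)%:E)%E).
  by apply: lee_wpmul2l; rewrite ?lee_fin.
by rewrite -EFinM lee_fin le_eqVlt; apply/orP; left; apply/eqP; ring.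
Qed.

End Cutoff.

Section HeightCutoff.
Set Implicit Arguments.
Unset Strict Implicit.
Context {R : realType}.
Local Notation mu := (@circle_measure R).

Lemma powR_exprn (x p : R) n : 0 <= x -> (x ^+ n) `^ p = (x `^ p) ^+ n.
Proof.
move=> x0; rewrite -(powR_mulrn n x0) -(powR_mulrn n (powR_ge0 x p)).
by rewrite -(powRrM x n%:R p) -(powRrM x p n%:R) mulrC.
Qed.

Lemma measurable_superlevel (F : circle R -> R) (k : R) :
  measurable_fun setT F -> measurable [set w | k < F w].
Proof.
move=> mF; rewrite -[X in measurable X]setTI.
rewrite (_ : [set w | _] = F @^-1` `]k, +oo[); last first.
  by apply/seteqP; split => w /=; rewrite in_itv/= andbT.
exact: mF.
Qed.

Lemma height_markov (F : circle R -> R) (p B k : R) :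
  measurable_fun setT F -> (forall w, 0 <= F w) -> 0 <= p -> 0 < k ->
  (\int[mu]_w (F w `^ p)%:E <= B%:E)%E ->
  (mu [set w | (k < F w)%R] <= (B / k `^ p)%:E)%E.
Proof.
move=> mF F0 p0 k0 FB; have mE := measurable_superlevel k mF.
set E := [set w | _] in mE *.
have kp : 0 < k `^ p by exact: powR_gt0.
have fE : mu E \is a fin_num by exact: fin_num_measure.
rewrite -(fineK fE) lee_fin ler_pdivlMr// mulrC -lee_fin EFinM fineK//.
apply: le_trans FB; rewrite -(setIT E) -integral_indic//.
rewrite -ge0_integralZl_EFin ?(ltW kp)//; last first.
  by apply/measurable_EFinP; exact: measurable_indic.
apply: ge0_le_integral => //.
- by move=> w _; rewrite -EFinM lee_fin mulr_ge0// ltW.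
- apply/measurable_EFinP; apply: measurable_funM => //; exact: measurable_indic.
- apply/measurable_EFinP; apply: (measurableT_comp (measurable_powR p)) => //.
move=> w _; rewrite -EFinM lee_fin indicE.
case: (boolP (w \in E)) => [|_]; last by rewrite mulr0 powR_ge0.
rewrite inE /E/= mulr1 => kF; by apply: ge0_ler_powR; rewrite ?nnegrE ?(ltW k0) ?(ltW kF).
Qed.

(** Normalised to height 1, for use with [F = |f| / l] and [B = l^(-p)]. *)
Lemma bounded_cutoff (p : R) : 1 < p -> exists2 C : R, 0 <= C &
  forall (F : circle R -> R) (B : R), measurable_fun setT F ->
  (forall w, 0 <= F w) -> 0 < B -> (\int[mu]_w (F w `^ p)%:E <= B%:E)%E ->
  exists phi, [/\ multiplier phi, forall w, modulus (phi w) <= 1,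
    {ae mu, forall w, F w * modulus (phi w) ^+ 2 <= 1} &
    (\int[mu]_w (modulus (1 - phi w) ^+ 2)%:E <= (C * B)%:E)%E].
Proof.
(* Markov's inequality bounds the measure of [F > 4^j] by [B 4^(-j p) = B rho^(2 j)], the square of
   [d j] below. Against weights of order [2^j] the series has ratio [2 rho], less than 1 because
   [p > 1]. *)
move=> p1; pose rho : R := 2 `^ (- p).
have rho0 : 0 < rho by exact: powR_gt0.
have rho2 : 2 * rho < 1.
  have p10 : 0 < p - 1 by rewrite subr_gt0.
  have p21 : 1 < (2 : R) `^ (p - 1).
    have := gt0_ltr_powR p10 (_ : 1 \in Num.nneg) (_ : 2 \in Num.nneg) (ltr1n R 2).
    by rewrite powR1; apply; rewrite nnegrE.
  have -> : rho = (2 `^ (p - 1) * 2)^-1.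
    rewrite /rho powRN; congr GRing.inv; rewrite -{3}(powRr1 (ler0n R 2)) -powRD ?subrK//.
    by rewrite pnatr_eq0 implybT.
  by rewrite invfM mulrC divfK ?pnatr_eq0// invf_lt1// (lt_trans ltr01).
exists (6 * (4 / (1 - 2 * rho)) ^+ 2); first by rewrite mulr_ge0// sqr_ge0.
move=> F B mF F0 B0 FB.
pose s := Num.sqrt B; have s0 : 0 < s by rewrite sqrtr_gt0.
have sB : s ^+ 2 = B by rewrite sqr_sqrtr// ltW.
pose d j := s * rho ^+ j.
pose E j := [set w | 4 ^+ j < F w].
have d0 j : 0 < d j by rewrite mulr_gt0// exprn_gt0.
have ED j : (mu (E j) <= (d j ^+ 2)%:E)%E.
  have p0 : 0 <= p by lra.
  apply: le_trans (height_markov mF F0 p0 (exprn_gt0 j (ltr0Sn R 3)) FB) _.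
  rewrite lee_fin powR_exprn// /d exprMn sB ler_pM2l//.
  rewrite (_ : 4 = 2 ^+ 2); last by ring.
  by rewrite powR_exprn// /rho powRN !exprVn -!exprM mulnC.
have mE j : measurable (E j) by exact: measurable_superlevel.
have Dc : d j ^+ 2 @[j --> \oo] --> (0 : R).
  have -> : (fun j => d j ^+ 2) = geometric B (rho ^+ 2).
    by apply/funext => j; rewrite /= /d exprMn sB exprAC.
  apply: cvg_geometric; rewrite ger0_norm ?sqr_ge0// expr_lt1//; last exact: ltW.
  by lra.
have [t [pt t01 td cov]] := trig_poly_cover mE (fun j => exprn_gt0 2 (d0 j)) Dc ED.
(* If [t i >= 1/2] for some [i >= n], then [1 + c i * t i >= 2^(n + 1)], which is at least the
   square root of [F] as long as [F <= 4^(n + 1)]. *)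
pose c j : R := 4 * 2 ^+ j.
have c0 j : 0 < c j by rewrite mulr_gt0// exprn_gt0.
pose A := 4 * s / (1 - 2 * rho).
have cdA n : \sum_(0 <= j < n) c j * d j <= A.
  have s40 : 0 <= 4 * s by rewrite mulr_ge0// ltW.
  have r20 : 0 < 2 * rho by rewrite mulr_gt0.
  have r21 : `|2 * rho| < 1 by rewrite gtr0_norm.
  apply: le_trans (geometric_le_lim n s40 r20 r21).
  rewrite /series/= le_eqVlt; apply/orP; left; apply/eqP; apply: eq_bigr => j _.
  by rewrite /c /d exprMn; ring.
have [phi [mphi phi1 phit phiA]] := analytic_cutoff pt t01 c0 d0 td cdA.
exists phi; split => //; last first.
  apply: le_trans phiA _; rewrite lee_fin /A -sB le_eqVlt; apply/orP; left; apply/eqP.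
  by field; lra.
apply: filterS2 phit cov => w phiw Ew.
have m0 := modulus_ge0 (phi w).
have [Fw|Fw] := leP (F w) 1.
  by rewrite mulr_ile1 ?sqr_ge0 ?exprn_ile1.
have exn : exists n, F w <= 4 ^+ n.
  exists (Num.bound (F w)); apply: ltW; apply: lt_trans (archi_boundP (F0 w)) _.
  by rewrite -natrX ltr_nat ltn_expl.
(* Minimality puts [F w] between [4^n] and [4^(n + 1)]; a minimal index 0 would mean [F w <= 1]. *)
case: (ex_minnP exn) => -[|n]; first by rewrite expr0 leNgt Fw.
move=> Fn min; have nE : E n w.
  by rewrite /E/= ltNge; apply/negP => /min; rewrite ltnn.
have [i ni ti] := Ew n nE.
have le2 : 2 * 2 ^+ n * modulus (phi w) <= 1.
  apply: le_trans (phiw i); apply: ler_wpM2r => //.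
  have : (2 : R) ^+ n <= 2 ^+ i by rewrite ler_eXn2l// ltr1n.
  have : c i * 2^-1 <= c i * t i w by rewrite ler_pM2l.
  by rewrite {1}/c; lra.
apply: (@le_trans _ _ (4 ^+ n.+1 * modulus (phi w) ^+ 2)).
  by apply: ler_wpM2r => //; exact: sqr_ge0.
rewrite (_ : _ * _ = (2 * 2 ^+ n * modulus (phi w)) ^+ 2).
  by rewrite exprn_ile1// mulr_ge0// mulr_ge0// exprn_ge0.
rewrite !exprMn -exprM mulnC exprM exprS.
by rewrite (_ : 2 ^+ 2 = 4 :> R)//; ring.
Qed.

End HeightCutoff.

(** * The decomposition *)

Section HardySpaces.
Set Implicit Arguments.
Unset Strict Implicit.
Context {R : realType}.
Local Notation mu := (@circle_measure R).
Implicit Types f : circle R -> R[i].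

Lemma circle_norm1 f : circle_norm 1%E f = (\int[mu]_w (modulus (f w))%:E)%E.
Proof.
rewrite /circle_norm Lnorm1; apply: eq_integral => w _.
by rewrite gee0_abs// lee_fin modulus_ge0.
Qed.

Lemma circle_norm_powR (p : R) f : 0 < p ->
  (circle_norm p%:E f `^ p = \int[mu]_w ((modulus (f w)) `^ p)%:E)%E.
Proof.
move=> p0; rewrite /circle_norm poweR_Lnorm ?gt_eqF//; apply: eq_integral => w _.
by rewrite gee0_abs// lee_fin modulus_ge0.
Qed.

Lemma circle_norm_infty_le f (M : R) :
  {ae mu, forall w, modulus (f w) <= M} -> (circle_norm +oo%E f <= M%:E)%E.
Proof.
move=> fM; rewrite /circle_norm unlock /= ifT; last first.
  by rewrite [X in (_ < X)%E](@circle_measure_setT R) lte_fin.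
apply/ess_supP; apply: filterS fM => w fwM.
by rewrite /= lee_fin ger0_norm ?modulus_ge0.
Qed.

Lemma hardy1_Hardy (q : \bar R) f : hardy1 f -> (circle_norm q f < +oo)%E ->
  Hardy q f.
Proof.
move=> hf fq; have [[[mr mi] _] _] := hf; split; first by split.
exact: hardy1_analytic.
Qed.

Lemma hardy1_Hardy1 f : hardy1 f -> Hardy 1%E f.
Proof.
move=> hf; apply: hardy1_Hardy => //; have [[_ /integrableP[_ H]] _] := hf.
rewrite circle_norm1; apply: le_lt_trans H; rewrite le_eqVlt; apply/orP; left; apply/eqP.
by apply: eq_integral => w _; rewrite /= ger0_norm// modulus_ge0.
Qed.

(** On a probability space [|f| <= 1 + |f|^p] gives integrability; the coefficients are then those
    of an analytic extension. *)
Lemma Hardy_hardy1 (p : R) f : 1 < p -> Hardy p%:E f -> hardy1 f.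
Proof.
move=> p1 [[mr mi fp] af]; have p0 : 0 < p by rewrite (lt_trans ltr01).
apply: analytic_hardy1 => //; have mf : cmeasurable f by split.
split => //; have mm := measurable_modulus mf.
have mmp : measurable_fun setT (fun w => modulus (f w) `^ p).
  exact: (measurableT_comp (measurable_powR p)).
have jp : mu.-integrable setT (fun w => (1 + modulus (f w) `^ p)%:E).
  have j1 : mu.-integrable setT (EFin \o cst (1 : R)).
    exact: finite_measure_integrable_cst.
  have j2 : mu.-integrable setT (EFin \o (fun w => modulus (f w) `^ p)).
    apply/integrableP; split; first exact/measurable_EFinP.
    have H : (circle_norm p%:E f `^ p < +oo)%E by exact: poweR_lty.
    rewrite circle_norm_powR// in H; apply: le_lt_trans H; rewrite le_eqVlt.
    apply/orP; left; apply/eqP; apply: eq_integral => w _.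
    by rewrite /= ger0_norm// powR_ge0.
  exact: (integrableD measurableT j1 j2).
apply: le_integrable jp => //; first exact/measurable_EFinP.
move=> w _ /=; rewrite lee_fin !ger0_norm ?addr_ge0 ?powR_ge0 ?modulus_ge0//.
have [m1|m1] := leP (modulus (f w)) 1.
  by rewrite (le_trans m1)// lerDl powR_ge0.
apply: le_trans (_ : modulus (f w) `^ p <= _); last by rewrite lerDr.
by rewrite -{1}(powRr1 (modulus_ge0 (f w))) ler_powR// ltW.
Qed.

End HardySpaces.

Theorem theorem2p1 (R : realType) (p : R) (p_gt1 : 1 < p) :
  exists Cp : R,
    forall (lambda : R) (f : circle R -> R[i]),
      0 < lambda -> Hardy p%:E f -> circle_norm p%:E f = 1%E ->
      exists f0 f1 : circle R -> R[i],
        [/\ Hardy 1%E f0,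
            Hardy +oo%E f1,
            {ae @circle_measure R, forall w, f w = f0 w + f1 w},
            (circle_norm +oo%E f1 <= lambda%:E)%E &
            (circle_norm 1%E f0 <= (Cp * lambda `^ (1 - p))%:E)%E].
Proof.
have [C C0 HC] := @bounded_cutoff R p p_gt1.
have p0 : 0 < p by rewrite (lt_trans ltr01).
(* The two terms of the final integral are [4 l * C l^(-p)] and [4 l^(1 - p)]; the last factor turns
   [lambda^(1 - p)] into [(lambda / 3)^(1 - p)]. *)
exists ((4 * C + 4) * (3^-1) `^ (1 - p)) => lambda f l0 Hf f1.
pose l := lambda / 3; have lp : 0 < l by rewrite divr_gt0.
have hf := Hardy_hardy1 p_gt1 Hf; have [[mf jf] _] := hf.
have mm := measurable_modulus mf.
have mmp : measurable_fun setT (fun w => modulus (f w) `^ p).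
  exact: (measurableT_comp (measurable_powR p)).
have fp : (\int[@circle_measure R]_w ((modulus (f w)) `^ p)%:E = 1)%E.
  by rewrite -circle_norm_powR// f1 poweR1r.
have B0 : 0 < l `^ (- p) by exact: powR_gt0.
have lV0 : 0 <= l^-1 by rewrite invr_ge0 ltW.
have lm0 w : 0 <= l^-1 * modulus (f w) by rewrite mulr_ge0 ?modulus_ge0.
have [||phi [mphi phi1 phif phi2]] := HC (fun w => l^-1 * modulus (f w)) _ _ lm0 B0.
- by apply: measurable_funM.
- under eq_integral do rewrite powRM// ?modulus_ge0// EFinM.
  rewrite ge0_integralZl_EFin ?powR_ge0//.
  + by rewrite fp mule1 lee_fin -powR_inv1 ?(ltW lp)// -powRrM mulN1r.
  + by move=> w _; rewrite lee_fin powR_ge0.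
  + exact/measurable_EFinP.
have [mpm _ _] := mphi.
pose g1 w := f w * (phi w ^+ 2 * (2%:R - phi w ^+ 2)).
pose g0 w := f w - g1 w.
have mpsi : multiplier (fun w => phi w ^+ 2 * (2%:R - phi w ^+ 2)).
  apply: multiplierM; first exact: multiplierX.
  by apply: multiplierB; [exact: multiplier_cst|exact: multiplierX].
have hg1 : hardy1 g1 by have [_ _ H] := mpsi; exact: H.
have hg0 : hardy1 g0.
  apply: hardy1D => //; have := hardy1Z (-1) hg1.
  by under eq_fun do rewrite mulN1r.
have n2 : modulus (2%:R : R[i]) = 2.
  have -> : 2%:R = ((2 : R)%:C)%C :> R[i] by rewrite rmorphMn.
  by rewrite modulus_real ger0_norm.
have g1l : {ae @circle_measure R, forall w, modulus (g1 w) <= lambda}.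
  apply: filterS phif => w.
  rewrite -mulrA ler_pdivrMl// mulr1 => fw.
  (* This 3 is the reason for [l = lambda / 3]. *)
  have m2 : modulus (2%:R - phi w ^+ 2) <= 3.
    apply: le_trans (modulusB _ _) _; rewrite n2 modulusX.
    have := exprn_ile1 2 (modulus_ge0 (phi w)) (phi1 w); lra.
  rewrite /g1 mulrA Normc.normcM.
  have -> : lambda = l * 3 by rewrite /l divfK.
  apply: ler_pM => //; rewrite ?modulus_ge0//.
  by rewrite Normc.normcM modulusX.
have n1 := circle_norm_infty_le g1l.
exists g0, g1; split; [exact: hardy1_Hardy1| |by apply: aeW => w; rewrite /g0 subrK|exact: n1|].
  by apply: hardy1_Hardy => //; apply: le_lt_trans n1 _; exact: ltry.
rewrite circle_norm1.
have lE : lambda `^ (1 - p) * (3^-1) `^ (1 - p) = l `^ (1 - p).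
  by rewrite /l powRM// ltW.
have m1phi : measurable_fun setT (fun w => modulus (1 - phi w) ^+ 2).
  apply: measurable_funX; apply: measurable_modulus.
  by apply: cmeasurableB => //; exact: cmeasurable_cst.
have lp0 : 0 <= 4 * l `^ (1 - p) by rewrite mulr_ge0// powR_ge0.
have l40 : 0 <= 4 * l by rewrite mulr_ge0// ltW.
have mA : measurable_fun setT (fun w => ((4 * l)%:E * (modulus (1 - phi w) ^+ 2)%:E)%E).
  by apply/measurable_EFinP; exact: measurable_funM.
have mB : measurable_fun setT (fun w => ((4 * l `^ (1 - p))%:E * (modulus (f w) `^ p)%:E)%E).
  by apply/measurable_EFinP; exact: measurable_funM.
have A0 w : (0 <= (4 * l)%:E * (modulus (1 - phi w) ^+ 2)%:E)%E.
  by rewrite -EFinM lee_fin mulr_ge0// sqr_ge0.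
have B0' w : (0 <= (4 * l `^ (1 - p))%:E * (modulus (f w) `^ p)%:E)%E.
  by rewrite -EFinM lee_fin mulr_ge0// powR_ge0.
have [[mg0 _] _] := hg0.
apply: (@le_trans _ _ (\int[@circle_measure R]_w ((4 * l)%:E * (modulus (1 - phi w) ^+ 2)%:E +
   (4 * l `^ (1 - p))%:E * (modulus (f w) `^ p)%:E))%E).
  apply: ge0_le_integral => //.
  - by move=> w _; rewrite lee_fin modulus_ge0.
  - by apply/measurable_EFinP; exact: measurable_modulus.
  - exact: emeasurable_funD.
  move=> w _; rewrite -!EFinM -EFinD lee_fin.
  have -> : g0 w = f w * (1 - phi w ^+ 2) ^+ 2 by rewrite /g0 /g1; ring.
  rewrite Normc.normcM modulusX.
  have u0 := modulus_ge0 (1 - phi w ^+ 2).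
  have u2 : modulus (1 - phi w ^+ 2) <= 2.
    apply: le_trans (modulusB _ _) _; rewrite Normc.normc1 modulusX.
    have := exprn_ile1 2 (modulus_ge0 (phi w)) (phi1 w); lra.
  have v2 : modulus (1 - phi w ^+ 2) <= 2 * modulus (1 - phi w).
    rewrite (_ : 1 - _ = (1 + phi w) * (1 - phi w)); last by ring.
    rewrite Normc.normcM; apply: ler_wpM2r; first exact: modulus_ge0.
    apply: le_trans (modulusD _ _) _; rewrite Normc.normc1.
    by have := phi1 w; lra.
  have v0 := modulus_ge0 (1 - phi w); have f0 := modulus_ge0 (f w).
  move: (modulus (1 - phi w ^+ 2)) (modulus (1 - phi w)) (modulus (f w)) u0 u2 v2 v0 f0.
  move=> u v m u0 u2 v2 v0 m0.
  (* Where [|f| <= l] the bound [u <= 2 v] brings in [|1 - phi|^2]; elsewhere [u <= 2] suffices. *)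
  have [ml|lm] := leP m l.
    apply: (@le_trans _ _ (4 * l * v ^+ 2)); last first.
      by rewrite lerDl mulr_ge0// powR_ge0.
    rewrite (_ : 4 * l * v ^+ 2 = l * (2 * v) ^+ 2); last by ring.
    apply: ler_pM => //; first exact: sqr_ge0.
    by rewrite ler_pXn2r ?nnegrE// mulr_ge0.
  apply: (@le_trans _ _ (4 * l `^ (1 - p) * m `^ p)); last first.
    by rewrite lerDr mulr_ge0// sqr_ge0.
  have mpos : 0 < m by exact: lt_trans lm.
  have mp : m `^ p = m * m `^ (p - 1).
    rewrite -{2}(powRr1 m0) -powRD; last by rewrite (gt_eqF mpos) implybT.
    by rewrite addrC subrK.
  (* From [m > l] and [p > 1], [(m / l)^(p - 1) >= 1], that is [m <= l^(1 - p) m^p]. *)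
  have lml : 1 <= l `^ (1 - p) * m `^ (p - 1).
    rewrite -(opprB p 1) powRN mulrC ler_pdivlMr ?powR_gt0// mul1r.
    apply: ge0_ler_powR; rewrite ?nnegrE ?(ltW lp) ?(ltW lm) ?m0//.
    by rewrite subr_ge0 ltW.
  apply: (@le_trans _ _ (4 * m)).
    rewrite (_ : 4 * m = m * 2 ^+ 2); last by ring.
    by apply: ler_wpM2l => //; rewrite ler_pXn2r ?nnegrE.
  have -> : 4 * l `^ (1 - p) * m `^ p = 4 * m * (l `^ (1 - p) * m `^ (p - 1)).
    by rewrite mp; ring.
  by rewrite ler_peMr// mulr_ge0.
rewrite ge0_integralD//=.
rewrite ge0_integralZl_EFin//; [|by move=> w _; rewrite lee_fin sqr_ge0|exact/measurable_EFinP].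
rewrite ge0_integralZl_EFin//; [|by move=> w _; rewrite lee_fin powR_ge0|exact/measurable_EFinP].
rewrite fp mule1.
apply: (@le_trans _ _ ((4 * l)%:E * (C * l `^ (- p))%:E + (4 * l `^ (1 - p))%:E)%E).
  by apply: leeD => //; apply: lee_wpmul2l; rewrite ?lee_fin.
rewrite -EFinM -EFinD lee_fin -mulrA [_ `^ (1 - p) * lambda `^ _]mulrC lE.
have -> : l `^ (1 - p) = l * l `^ (- p).
  rewrite -{2}(powRr1 (ltW lp)) -powRD//.
  by rewrite (gt_eqF lp) implybT.
by rewrite le_eqVlt; apply/orP; left; apply/eqP; ring.
Qed.
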